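(* Let $r,n\ge 1$ be integers and let $\gamma$ be a piecewise smooth path on $V_{rn}$ from the tangential base point $\overrightarrow{01}$ to a point $z\in V_{rn}$. Then for every word $w\in\mathsf M_r$, $$\mathsf{Li}_w\bigl(\overrightarrow{01}\overset{\pi_{rn,r}(\gamma)}{\rightsquigarrow} z^n\bigr)=n^{\mathsf{wt}_X(w)}\sum_{\substack{u\in\mathsf M_{rn}\\ u\equiv w \bmod r}}\mathsf{Li}_u\bigl(\overrightarrow{01}\overset{\gamma}{\rightsquigarrow} z\bigr).$$
   Context: For $m\ge1$ let $\mu_m$ be the group of $m$-th roots of unity, $\zeta_m=e^{2\pi i/m}$, and $V_m=\mathbf P^1(\mathbb C)\setminus(\{0,\infty\}\cup\mu_m)$. Let $\mathcal R_m=\mathbb C\langle\langle X_m,Y_{0,m},\dots,Y_{m-1,m}\rangle\rangle$ be the ring of non-commutative formal power series, and let $\omega(V_m)=\frac{dz}{z}X_m+\sum_{i=0}^{m-1}\frac{dz}{z-\zeta_m^i}Y_{i,m}$ (the letters $X_m$, $Y_{i,m}$ being dual to the forms $dz/z$, $dz/(z-\zeta_m^i)$). For a piecewise smooth path $\gamma:[0,1]\to V_m$, let $\Phi:[0,1]\to\mathcal R_m$ solve $d\Phi=\Phi\,\gamma^*\omega(V_m)$ with $\Phi(0)=1$ and put $\Lambda(\gamma)=\Phi(1)$; for paths starting at the tangential base point $\overrightarrow{01}$ (unit tangent vector at $0$ pointing towards $1$) $\Lambda$ is defined by the standard (Deligne) regularization at the tangential base point. Let $\mathsf M_m$ be the set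 of nonempty monomials (words) in $X_m,Y_{0,m},\dots,Y_{m-1,m}$ and write $\Lambda(\gamma)=1+\sum_{w\in\mathsf M_m}\mathsf{Li}_w(\gamma)\,w$; thus for $w=X_m^{a_0}Y_{i_1,m}X_m^{a_1}\cdots Y_{i_k,m}X_m^{a_k}$, $\mathsf{Li}_w(\gamma)$ is the (regularized) iterated integral along $\gamma$ of $(dz/z)^{a_0}\,\frac{dz}{z-\zeta_m^{i_1}}\,(dz/z)^{a_1}\cdots\frac{dz}{z-\zeta_m^{i_k}}\,(dz/z)^{a_k}$. For such $w$, $\mathsf{wt}_X(w)=a_0+\cdots+a_k$. For $u\in\mathsf M_{rn}$, ''$u \bmod r$'' is the word of $\mathsf M_r$ obtained by replacing each letter $X_{rn}$ by $X_r$ and each $Y_{j,rn}$ by $Y_{i,r}$ where $0\le i<r$, $i\equiv j\pmod r$; $u\equiv w\bmod r$ means $(u\bmod r)=w$. $\pi_{rn,r}:V_{rn}\to V_r$ is the cyclic cover $z\mapsto z^n$, which sends the tangential base point $\overrightarrow{01}$ of $V_{rn}$ to (a tangential base point identified with) $\overrightarrow{01}$ on $V_r$; $\pi_{rn,r}(\gamma)$ is the image path from $\overrightarrow{01}$ to $z^n$. *)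

(* Defs.v *)
From Stdlib Require Import Reals.
From Coquelicot Require Import Coquelicot.
From mathcomp Require Import all_boot.

Set Implicit Arguments.
Unset Strict Implicit.
Unset Printing Implicit Defensive.

Local Open Scope R_scope.

(** * Words and non-commutative power series *)

(** The alphabet [X_m, Y_{0,m}, ..., Y_{m-1,m}]: [None] is [X_m] and [Some i]
    is [Y_{i,m}]. *)
Definition letter (m : nat) := option 'I_m.
Definition word (m : nat) := seq (letter m).

Definition letterX {m : nat} : letter m := None.
Definition letterY {m : nat} (i : 'I_m) : letter m := Some i.

Definition wtX {m : nat} (w : word m) : nat := count_mem letterX w.

Lemma ltn_ord_modn (r n : nat) (j : 'I_(r * n)) : (j %% r < r)%N.
Proof. by case: r j => [[]//|r] j; rewrite ltn_pmod. Qed.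

Definition letter_mod {r n : nat} (a : letter (r * n)) : letter r :=
  omap (fun j => Ordinal (ltn_ord_modn j)) a.
Definition word_mod {r n : nat} (u : word (r * n)) : word r :=
  map letter_mod u.

(** A formal series is identified with the family of its coefficients. *)
Definition ncseries (m : nat) := word m -> C.

Definition nc1 {m : nat} : ncseries m :=
  fun w => if w is [::] then RtoC 1 else RtoC 0.

Definition ncmul {m : nat} (S T : ncseries m) : ncseries m :=
  fun w => \big[Cplus/RtoC 0]_(k < (size w).+1)
             Cmult (S (take k w)) (T (drop k w)).

(** [exp (c X_m)], i.e. the series with coefficient [c^k / k!] at [X_m^k]. *)
Definition ncexpX {m : nat} (c : C) : ncseries m :=
  fun w => if all (pred1 letterX) w
           then Cdiv (Cpow c (size w)) (RtoC (INR (size w)`!))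
           else RtoC 0.

(** * The curve [V_m], the form [omega(V_m)] and its parallel transport *)

Definition zeta (m : nat) : C :=
  (cos (2 * PI / INR m), sin (2 * PI / INR m)).

Definition V (m : nat) (z : C) : Prop := z <> RtoC 0 /\ Cpow z m <> RtoC 1.

(** The value of [omega(V_m)] at [z], with the factor [dz] left out. *)
Definition omega (m : nat) (z : C) : ncseries m :=
  fun w => match w with
           | [:: None] => Cinv z
           | [:: Some i] => Cinv (Cminus z (Cpow (zeta m) (nat_of_ord i)))
           | _ => RtoC 0
           end.
Arguments omega : clear implicits.

Definition is_velocity (g : R -> C) (t : R) (v : C) : Prop :=
  is_derive (K := R_AbsRing) (V := C_R_NormedModule) g t v.

(** [g] has a C^1 extension to the whole line, which amounts to being C^1 on
    [[a, b]] with one-sided derivatives at the end points. *)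
Definition C1_on (a b : R) (g : R -> C) : Prop :=
  exists h h' : R -> C,
    (forall t, is_velocity h t (h' t)) /\
    (forall t, continuous h' t) /\
    (forall t, a <= t <= b -> g t = h t).

Definition piecewise_C1 (g : R -> C) : Prop :=
  exists (k : nat) (tau : nat -> R),
    tau 0%N = 0 /\ tau k = 1 /\
    (forall i, (i < k)%N ->
       tau i < tau i.+1 /\ C1_on (tau i) (tau i.+1) g).

(** [Phi] solves [d Phi = Phi . g^* omega(V_m)], [Phi(a) = 1] on [[a, b]],
    coefficient by coefficient.  Where the piecewise C^1 path [g] has a corner,
    only the continuity of [Phi] is required. *)
Definition solves_transport (m : nat) (g : R -> C) (a b : R)
    (Phi : R -> ncseries m) : Prop :=
  forall w : word m,
    Phi a w = nc1 w /\
    continuous_on (fun t => a <= t <= b) (fun t => Phi t w) /\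
    (forall t v, a < t < b -> is_velocity g t v ->
       is_velocity (fun s => Phi s w) t
         (Cmult v (ncmul (Phi t) (omega m (g t)) w))).

(** [Phi(b)], for the solution [Phi] on [[a, b]]: this is [Lambda] of the
    restriction of [g] to [[a, b]]. *)
Definition transport (m : nat) (g : R -> C) (a b : R) : ncseries m :=
  fun w => Hierarchy.iota (T := C_R_CompleteNormedModule)
    (fun c => exists Phi, solves_transport g a b Phi /\ c = Phi b w).
Arguments transport : clear implicits.

(** * Tangential base point *)

(** Paths on [V_m] from the tangential base point [01] to [z].  Only the initial
    direction of the path is prescribed, not its speed: the regularization below
    is invariant under reparametrization, and the class is stable under
    [z |-> z^n], although this map kills the derivative at [0]. *)
Definition tangential_path (m : nat) (g : R -> C) (z : C) : Prop :=
  [/\ piecewise_C1 g, g 0 = RtoC 0, g 1 = z,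
      forall t, 0 < t <= 1 -> V m (g t)
    & filterlim (fun t => Cdiv (g t) (RtoC (Cmod (g t))))
        (at_right 0) (locally (RtoC 1))].

(** Deligne's regularization
    [lim_(e -> 0+) exp(log |g(e)| X_m) Lambda(g restricted to [e, 1])]; here
    [|g(e)|] is the coordinate of the point of the ray [01] close to [g(e)].  If
    [g'(0) = 1] then [log e] in place of [log |g(e)|] gives the same limit. *)
Definition Lambda (m : nat) (g : R -> C) : ncseries m :=
  fun w => Hierarchy.iota (T := C_R_CompleteNormedModule)
    (fun c => filterlim
       (fun e => ncmul (ncexpX (RtoC (ln (Cmod (g e))))) (transport m g e 1) w)
       (at_right 0) (locally c)).
Arguments Lambda : clear implicits.

Definition Li {m : nat} (w : word m) (g : R -> C) : C := Lambda m g w.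

Definition cover_path (n : nat) (g : R -> C) : R -> C := fun t => Cpow (g t) n.

(* Main.v *)
Require Import Defs.
From HB Require Import structures.
From Stdlib Require Import Reals Lra Psatz ClassicalEpsilon.
From Coquelicot Require Import Coquelicot.
From mathcomp Require Import all_boot.

Set Implicit Arguments.
Unset Strict Implicit.
Unset Printing Implicit Defensive.

Local Open Scope R_scope.

(** The substitution [X |-> n X, Y_j |-> Y_(j mod r)] is multiplicative on
    series, turns [omega(V_rn)] into the pull-back of [omega(V_r)] under
    [z |-> z^n] (partial fractions), and turns [exp(log|g| X)] into
    [exp(log|g^n| X)].  Hence it maps the regularized transport along [g] on
    every [[e, 1]] to the one along [g^n], and it only remains to see that the
    limit [e -> 0] exists.  As [g] may oscillate near [0], this limit cannot be
    obtained by absolute convergence along the path: near the tangential base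
    point one needs the analytic solution [exp(log z X) + R(z)], where the
    coefficients of [R] are combinations of [(log z)^j] with power series
    vanishing at [0]. *)

(** * Limits and velocities of complex functions *)

(** [transport] and [Lambda] are definite descriptions, so computing one of their values takes a
    solution or a limit together with its uniqueness. Existence is proved for [gamma] alone: on
    [V_r] the push-forward of that solution serves, so the image path never has to be shown
    tangential or piecewise C^1. The transport equation speaks only of times at which the path has a
    velocity, and the uniqueness statements tolerate a finite set of times without one. In the
    remainder, power series have coefficients bounded by M 2^k because multiplication by z / (z - a)
    with |a| = 1 preserves this growth; on the disc of radius 1/8 the terms are then at most M
    (1/4)^k, which leaves room to differentiate termwise by elementary estimates. Primitives of f(z)
    / z are taken inside a class of functions tending to 0 at the base point, which settles the
    constants of integration. *)

Section ComplexLimits.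

Context {T : Type} (F : (T -> Prop) -> Prop) {FF : Filter F}.

Lemma filterlim_CP (f : T -> C) (a : C) :
  filterlim f F (locally a) <->
  forall eps : R, 0 < eps -> F (fun x => Cmod (f x - a)%C < eps).
Proof.
split=> [H eps eps0 | H].
- exact: (proj1 (filterlim_locally_ball_norm (K := C_AbsRing) (U := C_NormedModule)
    f a) H (mkposreal eps eps0)).
- apply/(filterlim_locally_ball_norm (K := C_AbsRing) (U := C_NormedModule)) => eps.
  exact: (H eps (cond_pos eps)).
Qed.

Lemma filterlim_Cpair (f : T -> C) (a : C) :
  filterlim (fun x => (f x).1) F (locally a.1) ->
  filterlim (fun x => (f x).2) F (locally a.2) ->
  filterlim f F (locally a).
Proof.
move=> /filterlim_locally H1 /filterlim_locally H2.
apply/filterlim_locally => eps.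
by apply: filter_imp (filter_and _ _ (H1 eps) (H2 eps)).
Qed.

Lemma filterlim_Cfst (f : T -> C) (a : C) :
  filterlim f F (locally a) -> filterlim (fun x => (f x).1) F (locally a.1).
Proof.
move=> /filterlim_locally H; apply/filterlim_locally => eps.
by apply: filter_imp (H eps) => x [].
Qed.

Lemma filterlim_Csnd (f : T -> C) (a : C) :
  filterlim f F (locally a) -> filterlim (fun x => (f x).2) F (locally a.2).
Proof.
move=> /filterlim_locally H; apply/filterlim_locally => eps.
by apply: filter_imp (H eps) => x [].
Qed.

Lemma filterlim_Cplus (f g : T -> C) (a b : C) :
  filterlim f F (locally a) -> filterlim g F (locally b) ->
  filterlim (fun x => (f x + g x)%C) F (locally (a + b)%C).
Proof.
move=> Hf Hg; apply: (filterlim_comp_2 _ _ _ Hf Hg).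
exact: (@filterlim_plus _ C_NormedModule).
Qed.

Lemma filterlim_Rmult (f g : T -> R) (a b : R) :
  filterlim f F (locally a) -> filterlim g F (locally b) ->
  filterlim (fun x => f x * g x) F (locally (a * b)).
Proof.
move=> Hf Hg; apply: (filterlim_comp_2 _ _ _ Hf Hg).
exact: (@filterlim_mult R_AbsRing).
Qed.

Lemma filterlim_Rplus (f g : T -> R) (a b : R) :
  filterlim f F (locally a) -> filterlim g F (locally b) ->
  filterlim (fun x => f x + g x) F (locally (a + b)).
Proof.
move=> Hf Hg; apply: (filterlim_comp_2 _ _ _ Hf Hg).
exact: (@filterlim_plus _ R_NormedModule).
Qed.

Lemma filterlim_Ropp (f : T -> R) (a : R) :
  filterlim f F (locally a) -> filterlim (fun x => - f x) F (locally (- a)).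
Proof.
move=> Hf; apply: (filterlim_comp _ _ _ _ _ _ _ _ Hf).
exact: (@filterlim_opp _ R_NormedModule).
Qed.

Lemma filterlim_Rinv (f : T -> R) (a : R) : a <> 0 ->
  filterlim f F (locally a) -> filterlim (fun x => / f x) F (locally (/ a)).
Proof.
move=> a0 Hf; apply: (filterlim_comp _ _ _ _ _ _ _ _ Hf).
exact: (continuous_Rinv a a0).
Qed.

Lemma filterlim_Cmult (f g : T -> C) (a b : C) :
  filterlim f F (locally a) -> filterlim g F (locally b) ->
  filterlim (fun x => (f x * g x)%C) F (locally (a * b)%C).
Proof.
move=> Hf Hg; have Hf1 := filterlim_Cfst Hf; have Hf2 := filterlim_Csnd Hf.
have Hg1 := filterlim_Cfst Hg; have Hg2 := filterlim_Csnd Hg.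
apply: filterlim_Cpair => /=.
- by apply: filterlim_Rplus; [|apply: filterlim_Ropp]; apply: filterlim_Rmult.
- by apply: filterlim_Rplus; apply: filterlim_Rmult.
Qed.

Lemma filterlim_Cconst (a : C) : filterlim (fun _ : T => a) F (locally a).
Proof. exact: filterlim_const. Qed.

Lemma filterlim_Copp (f : T -> C) (a : C) :
  filterlim f F (locally a) -> filterlim (fun x => (- f x)%C) F (locally (- a)%C).
Proof.
move=> Hf; apply: (filterlim_comp _ _ _ _ _ _ _ _ Hf).
exact: (@filterlim_opp _ C_NormedModule).
Qed.

Lemma filterlim_Cminus (f g : T -> C) (a b : C) :
  filterlim f F (locally a) -> filterlim g F (locally b) ->
  filterlim (fun x => (f x - g x)%C) F (locally (a - b)%C).
Proof. by move=> Hf Hg; apply: filterlim_Cplus => //; apply: filterlim_Copp. Qed.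

Lemma Cnormsq_neq0 (a : C) : a <> 0 -> a.1 ^ 2 + a.2 ^ 2 <> 0.
Proof.
case: a => x y /= H E; apply: H.
have [-> ->] : x = 0 /\ y = 0 by split; nra.
by [].
Qed.

Lemma filterlim_Cinv (f : T -> C) (a : C) : a <> 0 ->
  filterlim f F (locally a) -> filterlim (fun x => (/ f x)%C) F (locally (/ a)%C).
Proof.
move=> a0 Hf; have Hf1 := filterlim_Cfst Hf; have Hf2 := filterlim_Csnd Hf.
have HN : filterlim (fun x => / ((f x).1 ^ 2 + (f x).2 ^ 2)) F
    (locally (/ (a.1 ^ 2 + a.2 ^ 2))).
  apply: filterlim_Rinv; first exact: Cnormsq_neq0.
  rewrite /= ; apply: filterlim_Rplus; (apply: filterlim_Rmult => //);
    by (apply: filterlim_Rmult => //); exact: filterlim_const.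
apply: filterlim_Cpair; rewrite /Cinv /Rdiv /=; apply: filterlim_Rmult => //.
exact: filterlim_Ropp.
Qed.

Lemma filterlim_Cpow (f : T -> C) (a : C) k :
  filterlim f F (locally a) -> filterlim (fun x => (f x ^ k)%C) F (locally (a ^ k)%C).
Proof.
move=> Hf; elim: k => [|k IH] /=; first exact: filterlim_Cconst.
exact: filterlim_Cmult.
Qed.

Lemma filterlim_Csum (I : Type) (r : seq I) (P : pred I) (f : I -> T -> C) (a : I -> C) :
  (forall i, filterlim (f i) F (locally (a i))) ->
  filterlim (fun x => \big[Cplus/RtoC 0]_(i <- r | P i) f i x) F
    (locally (\big[Cplus/RtoC 0]_(i <- r | P i) a i)).
Proof.
move=> H; elim: r => [|i r IH].
  rewrite big_nil; apply: filterlim_ext; last exact: filterlim_Cconst.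
  by move=> x; rewrite big_nil.
rewrite big_cons; apply: (filterlim_ext (fun x => if P i then (f i x +
  \big[Cplus/RtoC 0]_(j <- r | P j) f j x)%C else \big[Cplus/RtoC 0]_(j <- r | P j) f j x)).
  by move=> x; rewrite big_cons.
by case: (P i) => //; apply: filterlim_Cplus.
Qed.

End ComplexLimits.

Lemma Cmod_fst_le (z : C) : Rabs z.1 <= Cmod z.
Proof. exact: Rle_trans (Rmax_l _ _) (Rmax_Cmod z). Qed.

Lemma Cmod_snd_le (z : C) : Rabs z.2 <= Cmod z.
Proof. exact: Rle_trans (Rmax_r _ _) (Rmax_Cmod z). Qed.

Lemma norm_C_R (x : C) : norm (V := C_R_NormedModule) x = Cmod x.
Proof. by rewrite Cmod_norm. Qed.

(* Caratheodory's form of the derivative: it turns the chain rule and the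
   derivative of a local inverse into limit computations. *)
Lemma is_velocityP (g : R -> C) (t : R) (v : C) :
  is_velocity g t v <->
  exists q : R -> C, [/\ filterlim q (locally t) (locally v), q t = v
    & forall s, g s = (g t + RtoC (s - t) * q s)%C].
Proof.
split.
- case=> _ H; have {}H := H t (fun P HP => HP).
  pose q s := if excluded_middle_informative (s = t) then v
              else ((g s - g t) / RtoC (s - t))%C.
  have neq s : s <> t -> RtoC (s - t) <> 0 by move=> st [] E; apply: st; lra.
  exists q; split.
  + apply/filterlim_CP => eps eps0.
    have e2 : 0 < eps / 2 by lra.
    apply: filter_imp (H (mkposreal _ e2)) => s.
    rewrite /q; case: (excluded_middle_informative (s = t)) => [e0 _|st] /=.
      by replace (v - v)%C with (RtoC 0); [rewrite Cmod_0 | ring].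
    rewrite norm_C_R /= => Hs.
    have ap : 0 < Rabs (s - t) by apply: Rabs_pos_lt; lra.
    replace ((g s - g t) / RtoC (s - t) - v)%C with
      ((g s - g t - RtoC (s - t) * v) / RtoC (s - t))%C by
      (field; exact: neq).
    rewrite Cmod_div; last exact: neq.
    rewrite Cmod_R; apply: (Rmult_lt_reg_r (Rabs (s - t))) => //.
    rewrite /Rdiv Rmult_assoc Rinv_l ?Rmult_1_r; last by lra.
    apply: (Rle_lt_trans _ (eps / 2 * Rabs (s - t))); last by nra.
    have -> : (g s - g t - RtoC (s - t) * v)%C =
      minus (minus (g s) (g t)) (scal (K := R_AbsRing) (V := C_R_NormedModule)
        (minus s t) v).
      apply: injective_projections; rewrite /= /plus /= /opp /= /scal /= /mult /= /minus
        /plus /opp /=; ring.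
    exact: Hs.
  + by rewrite /q; case: (excluded_middle_informative (t = t)).
  + move=> s; rewrite /q; case: (excluded_middle_informative (s = t)) => [st|st] /=;
    first rewrite st.
      apply: injective_projections => /=; ring.
    by field; exact: neq.
- case=> q [/filterlim_CP Hq qt Hg]; split; first exact: is_linear_scal_l.
  move=> x Hx.
  have -> : x = t.
    by symmetry; apply: is_filter_lim_locally_unique.
  move=> eps; apply: filter_imp (Hq eps (cond_pos eps)) => s Hs.
  rewrite norm_C_R /=.
  apply: (Rle_trans _ (Cmod (RtoC (s - t) * (q s - v))%C)).
    apply: Req_le; congr Cmod; rewrite (Hg s).
    apply: injective_projections; rewrite /= /plus /= /opp /= /scal /= /mult /= /minus /plus
      /opp /=; ring.
  rewrite Cmod_mult Cmod_R Rmult_comm; apply: Rmult_le_compat_r; first exact: Rabs_pos.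
  exact: Rlt_le.
Qed.

Lemma RtoC_filterlim (t : R) : filterlim (fun s => RtoC (s - t)) (locally t) (locally (RtoC 0)).
Proof.
apply/filterlim_CP => eps e0; exists (mkposreal _ e0) => s Hs.
replace (RtoC (s - t) - 0)%C with (RtoC (s - t)) by ring.
by rewrite Cmod_R.
Qed.

Lemma is_velocity_continuous g t v : is_velocity g t v -> continuous g t.
Proof.
case/is_velocityP=> q [Hq _ Hg].
rewrite /continuous; replace (g t) with (g t + 0 * v)%C at 1 by ring.
apply: (filterlim_ext (fun s => (g t + RtoC (s - t) * q s)%C)) => [s|].
  by rewrite (Hg s).
apply: filterlim_Cplus; first exact: filterlim_Cconst.
by apply: filterlim_Cmult => //; exact: RtoC_filterlim.
Qed.

Lemma is_velocity_unique g t v w : is_velocity g t v -> is_velocity g t w -> v = w.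
Proof.
move=> /is_velocityP[q [Hq qt Hg]] /is_velocityP[q' [Hq' qt' Hg']].
(* Off [t] the two slopes agree, since s - t can be cancelled; their limits are compared along
   punctured neighbourhoods, which form a proper filter. *)
have L : filter_le (locally' t) (locally t) by apply: filter_le_within.
apply: (@filterlim_locally_unique R C_AbsRing C_NormedModule (locally' t) _ q).
  exact: (Proper_StrongProper _ (Rbar_locally'_filter (Rbar.Finite t))).
  exact: (filterlim_filter_le_1 _ L Hq).
apply: (filterlim_ext_loc q'); last first.
  exact: (filterlim_filter_le_1 _ L Hq').
exists (mkposreal 1 Rlt_0_1) => s _ st.
have E : (RtoC (s - t) * q s = RtoC (s - t) * q' s)%C.
  have := Hg s; rewrite {1}Hg' => H.
  replace (RtoC (s-t) * q' s)%C with (g t + RtoC (s-t) * q' s - g t)%C by ring.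
  by rewrite H; ring.
have n0 : RtoC (s - t) <> 0 by case=> ?; apply: st; lra.
replace (q' s) with (RtoC (s - t) * q' s / RtoC (s-t))%C by (field; exact: n0).
by rewrite -E; field.
Qed.

Lemma is_velocity_ext_loc (f g : R -> C) t v :
  locally t (fun s => f s = g s) -> is_velocity f t v -> is_velocity g t v.
Proof. exact: is_derive_ext_loc. Qed.

Lemma is_velocity_ext (f g : R -> C) t v :
  (forall s, f s = g s) -> is_velocity f t v -> is_velocity g t v.
Proof. by move=> E; apply: is_velocity_ext_loc; exact: filter_forall. Qed.

Lemma is_velocity_const (c : C) t : is_velocity (fun _ => c) t 0.
Proof. exact: (is_derive_const (K := R_AbsRing) (V := C_R_NormedModule) c t). Qed.

Lemma is_velocity_plus f g t v w : is_velocity f t v -> is_velocity g t w ->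
  is_velocity (fun s => f s + g s)%C t (v + w)%C.
Proof. exact: is_derive_plus. Qed.

Lemma is_velocity_mult f g t v w : is_velocity f t v -> is_velocity g t w ->
  is_velocity (fun s => f s * g s)%C t (v * g t + f t * w)%C.
Proof.
move=> Hf Hg; have Cg := is_velocity_continuous Hg.
move: Hf Hg => /is_velocityP[q [Hq qt Hf]] /is_velocityP[q' [Hq' qt' Hg]].
apply/is_velocityP; exists (fun s => q s * g s + f t * q' s)%C; split.
- by apply: filterlim_Cplus; apply: filterlim_Cmult => //; exact: filterlim_Cconst.
- by rewrite qt qt'.
- move=> s; rewrite [f s]Hf.
  replace (f t * g t)%C with (f t * (g s - RtoC (s-t) * q' s))%C; first ring.
  by rewrite [g s]Hg; ring.
Qed.

Lemma is_velocity_scal (c : C) f t v : is_velocity f t v ->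
  is_velocity (fun s => c * f s)%C t (c * v)%C.
Proof.
move=> H; have := is_velocity_mult (is_velocity_const c t) H.
by replace (0 * f t + c * v)%C with (c * v)%C by ring.
Qed.

Lemma is_velocity_sum (I : Type) (r : seq I) (P : pred I) (f : I -> R -> C) (v : I -> C) t :
  (forall i, is_velocity (f i) t (v i)) ->
  is_velocity (fun x => \big[Cplus/RtoC 0]_(i <- r | P i) f i x) t
    (\big[Cplus/RtoC 0]_(i <- r | P i) v i).
Proof.
move=> H; elim: r => [|i r IH].
  rewrite big_nil; apply: (is_velocity_ext (f := fun _ => RtoC 0)) => [x|].
    by rewrite big_nil.
  exact: is_velocity_const.
rewrite big_cons; apply: (@is_velocity_ext (fun x => if P i then (f i x +
  \big[Cplus/RtoC 0]_(j <- r | P j) f j x)%C else \big[Cplus/RtoC 0]_(j <- r | P j) f j x)).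
  by move=> x; rewrite big_cons.
by case: (P i) => //; apply: is_velocity_plus.
Qed.

(** [Q] is the slope of [F] from the point [g t], so the slope of the composite is the product of
    [q] and of [Q] along [g], and its limit is a product of limits. *)
Lemma is_velocity_comp (Q F : C -> C) g t v d :
  is_velocity g t v -> filterlim Q (locally (g t)) (locally d) -> Q (g t) = d ->
  (forall y, F y = F (g t) + (y - g t) * Q y)%C ->
  is_velocity (fun s => F (g s)) t (v * d)%C.
Proof.
move=> Hg HQ Qd HF; have Cg := is_velocity_continuous Hg.
case/is_velocityP: Hg => q [Hq qt Hg]; apply/is_velocityP.
exists (fun s => q s * Q (g s))%C; split.
- apply: filterlim_Cmult => //; exact: filterlim_comp Cg HQ.
- by rewrite qt Qd.
- by move=> s; rewrite [F (g s)]HF {1}(Hg s); ring.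
Qed.

(* Differentiability along all paths is weaker than complex differentiability,
   but it is all that is needed to pull functions back along paths. *)
Definition has_deriv (F : C -> C) (z d : C) : Prop :=
  filterlim F (locally z) (locally (F z)) /\
  forall (g : R -> C) (t : R) (v : C), g t = z -> is_velocity g t v ->
    is_velocity (fun s => F (g s)) t (v * d)%C.

Lemma has_deriv_ext (F G : C -> C) z d :
  (forall y, F y = G y) -> has_deriv F z d -> has_deriv G z d.
Proof.
move=> E [CF DF]; split; first by rewrite -E; apply: filterlim_ext CF.
by move=> g t v gt Hg; apply: is_velocity_ext (DF g t v gt Hg) => s.
Qed.

(** A quadratic remainder makes the difference quotient, completed by [d] at [z], continuous there.
    Termwise estimates of a power series yield its derivative in this form. *)
Lemma has_deriv_quadratic F z d K rho : 0 < rho ->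
  (forall y, Cmod (y - z)%C < rho ->
     Cmod (F y - F z - (y - z) * d)%C <= K * Cmod (y - z)%C ^ 2) ->
  has_deriv F z d.
Proof.
move=> rho0 H.
pose Q y := if excluded_middle_informative (y = z) then d else ((F y - F z) / (y - z))%C.
have neq y : y <> z -> (y - z)%C <> 0.
  move=> yz E; apply: yz; replace y with (y - z + z)%C by ring; rewrite E; ring.
have Qz : Q z = d by rewrite /Q; case: (excluded_middle_informative (z = z)).
have FQ y : (F y = F z + (y - z) * Q y)%C.
  rewrite /Q; case: (excluded_middle_informative (y = z)) => [yz|yz] /=.
    by rewrite yz; ring.
  by field; exact: neq.
have CQ : filterlim Q (locally z) (locally d).
  apply/filterlim_CP => eps e0.
  pose K' := Rabs K + 1; have K0 : 0 < K' by rewrite /K'; have := Rabs_pos K; lra.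
  have eK : 0 < eps / K' by apply: Rdiv_lt_0_compat.
  have /filterlim_CP L := filterlim_id C (locally z).
  apply: filter_imp (filter_and _ _ (L _ rho0) (L _ eK)) => y [y1 y2].
  rewrite /Q; case: (excluded_middle_informative (y = z)) => [e1|yz] /=.
    by replace (d - d)%C with (RtoC 0); [rewrite Cmod_0 | ring].
  have n0 := neq y yz.
  replace ((F y - F z) / (y - z) - d)%C with ((F y - F z - (y - z) * d) / (y - z))%C
    by (field; exact: n0).
  rewrite Cmod_div //; have := proj1 (Cmod_gt_0 _) n0; move: (H y y1) y2.
  set m := Cmod (y - z)%C => Hy y2 m0.
  apply: (Rmult_lt_reg_r m) => //.
  rewrite /Rdiv Rmult_assoc Rinv_l ?Rmult_1_r; last by lra.
  apply: (Rle_lt_trans _ (K' * m ^ 2)).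
    apply: Rle_trans Hy _; apply: Rmult_le_compat_r; first by apply: pow_le; lra.
    by rewrite /K'; have := Rle_abs K; lra.
  have : K' * m < eps.
    have := Rmult_lt_compat_l _ _ _ K0 y2.
    by replace (K' * (eps / K')) with eps by (field; lra).
  nra.
split; last by move=> g t v gt Hg; apply: (@is_velocity_comp Q); rewrite ?gt.
apply: (filterlim_ext (fun y => F z + (y - z) * Q y)%C) => [y|]; first by rewrite -FQ.
have {2}-> : F z = (F z + (z - z) * d)%C by ring.
apply: filterlim_Cplus; first exact: filterlim_Cconst.
apply: filterlim_Cmult => //; apply: filterlim_Cminus; last exact: filterlim_Cconst.
exact: filterlim_id.
Qed.

Lemma has_deriv_plus F G z d e : has_deriv F z d -> has_deriv G z e ->
  has_deriv (fun y => F y + G y)%C z (d + e)%C.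
Proof.
move=> [CF HF] [CG HG]; split; first exact: filterlim_Cplus.
move=> g t v gt Hg; have := is_velocity_plus (HF g t v gt Hg) (HG g t v gt Hg).
by rewrite Cmult_plus_distr_l.
Qed.

Lemma has_deriv_mult F G z d e : has_deriv F z d -> has_deriv G z e ->
  has_deriv (fun y => F y * G y)%C z (d * G z + F z * e)%C.
Proof.
move=> [CF HF] [CG HG]; split; first exact: filterlim_Cmult.
move=> g t v gt Hg; have := is_velocity_mult (HF g t v gt Hg) (HG g t v gt Hg).
rewrite gt; congr is_velocity; ring.
Qed.

Lemma has_deriv_const (c z : C) : has_deriv (fun _ => c) z 0.
Proof.
split; first exact: filterlim_Cconst.
by move=> g t v _ _; rewrite Cmult_0_r; exact: is_velocity_const.
Qed.

Lemma has_deriv_id (z : C) : has_deriv (fun y => y) z 1.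
Proof.
by split=> [|g t v _]; [exact: filterlim_id | rewrite Cmult_1_r].
Qed.

Lemma has_deriv_scal (c : C) F z d :
  has_deriv F z d -> has_deriv (fun y => c * F y)%C z (c * d)%C.
Proof.
move=> HF; have := has_deriv_mult (has_deriv_const c z) HF.
by congr has_deriv; ring.
Qed.

Lemma has_deriv_pow F z d k : has_deriv F z d ->
  has_deriv (fun y => F y ^ k.+1)%C z (RtoC (INR k.+1) * F z ^ k * d)%C.
Proof.
move=> HF; elim: k => [|k IH].
  have := HF; replace (INR 1 * F z ^ 0 * d)%C with d by (rewrite /=; ring).
  by apply: has_deriv_ext => y; rewrite Cpow_S Cmult_1_r.
have := has_deriv_mult HF IH.
congr has_deriv; rewrite (S_INR k.+1) RtoC_plus !Cpow_S; ring.
Qed.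

(** With these structures the generic lemmas on big operators (exchange, splitting, distributivity)
    apply to sums in [C]. *)
HB.instance Definition _ := Monoid.isComLaw.Build C (RtoC 0) Cplus
  Cplus_assoc Cplus_comm Cplus_0_l.
HB.instance Definition _ := Monoid.isMulLaw.Build C (RtoC 0) Cmult
  Cmult_0_l Cmult_0_r.
HB.instance Definition _ := Monoid.isAddLaw.Build C Cmult Cplus
  Cmult_plus_distr_r Cmult_plus_distr_l.

(** For a <= b, precomposing with this retraction onto [a, b] turns continuity on the segment into
    continuity on the line, the form in which the mean value theorem and the integrals below use
    it. *)
Definition clamp (a b t : R) : R := Rmax a (Rmin b t).

Lemma clamp_in a b t : a <= b -> a <= clamp a b t <= b.
Proof.
rewrite /clamp /Rmax /Rmin => ab.
by case: (Rle_dec b t) => ?; case: (Rle_dec a _) => /= ?; lra.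
Qed.

Lemma clamp_id a b t : a <= t <= b -> clamp a b t = t.
Proof.
rewrite /clamp /Rmax /Rmin => ab.
by case: (Rle_dec b t) => ?; case: (Rle_dec a _) => /= ?; lra.
Qed.

Lemma clamp_lipschitz a b s t : a <= b -> Rabs (clamp a b s - clamp a b t) <= Rabs (s - t).
Proof.
rewrite /clamp /Rmax /Rmin => ab.
case: (Rle_dec b s) => ?; case: (Rle_dec b t) => ? /=;
  case: (Rle_dec a s) => ? /=; case: (Rle_dec a t) => ? /=;
  (try case: (Rle_dec a b) => ? /=); split_Rabs; lra.
Qed.

Lemma continuous_clamp (U : UniformSpace) (f : R -> U) a b t : a <= b ->
  continuous_on (fun t => a <= t <= b) f -> continuous (fun s => f (clamp a b s)) t.
Proof.
move=> ab Hf P HP; have [eps He] := Hf _ (clamp_in t ab) P HP.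
exists eps => s Hs; apply: He; last exact: clamp_in.
exact: Rle_lt_trans (clamp_lipschitz s t ab) Hs.
Qed.

Lemma continuous_on_glue (U : UniformSpace) (f : R -> U) a b c :
  continuous_on (fun t => a <= t <= b) f -> continuous_on (fun t => b <= t <= c) f ->
  continuous_on (fun t => a <= t <= c) f.
Proof.
move=> H1 H2 x xac P HP.
case: (Rlt_le_dec x b) => xb.
  have [|e1 He1] := H1 x _ P HP; first lra.
  have d0 : 0 < b - x by lra.
  apply: (filter_imp _ _ _ (filter_and _ _ (locally_ball x e1) (locally_ball x (mkposreal _
    d0)))) => y [y1 /Rabs_lt_between' y2] yac; apply: He1 => //.
  by move: y2 => /=; lra.
have [|e1 He1] := H2 x _ P HP; first lra.
case: (Rlt_le_dec b x) => bx.
  have d0 : 0 < x - b by lra.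
  apply: (filter_imp _ _ _ (filter_and _ _ (locally_ball x e1) (locally_ball x (mkposreal _
    d0)))) => y [y1 /Rabs_lt_between' y2] yac; apply: He1 => //.
  by move: y2 => /=; lra.
case: (Rle_dec a b) => ab.
  have [|e2 He2] := H1 x _ P HP; first lra.
  apply: (filter_imp _ _ _ (filter_and _ _ (locally_ball x e1) (locally_ball x e2))) =>
    y [y1 y2] yac.
  by case: (Rle_dec y b) => yb; [apply: He2 | apply: He1] => //; lra.
by exists e1 => y y1 yac; apply: He1 => //; lra.
Qed.

Lemma is_velocity_fst g t v : is_velocity g t v -> is_derive (fun s => (g s).1) t v.1.
Proof.
case/is_velocityP=> q [/filterlim_CP Hq qt Hg]; apply/is_derive_Reals => eps e0.
have [d Hd] := Hq eps e0; exists d => h h0 hd.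
have -> : ((g (t + h)).1 - (g t).1) / h - v.1 = (Cminus (q (t + h)) v).1.
  by rewrite (Hg (t + h)) /=; field.
apply: Rle_lt_trans (Cmod_fst_le _) _; apply: Hd.
by rewrite /ball /= /AbsRing_ball /abs /minus /plus /opp /=; ring_simplify (t + h + - t).
Qed.

Lemma is_velocity_snd g t v : is_velocity g t v -> is_derive (fun s => (g s).2) t v.2.
Proof.
case/is_velocityP=> q [/filterlim_CP Hq qt Hg]; apply/is_derive_Reals => eps e0.
have [d Hd] := Hq eps e0; exists d => h h0 hd.
have -> : ((g (t + h)).2 - (g t).2) / h - v.2 = (Cminus (q (t + h)) v).2.
  by rewrite (Hg (t + h)) /=; field.
apply: Rle_lt_trans (Cmod_snd_le _) _; apply: Hd.
by rewrite /ball /= /AbsRing_ball /abs /minus /plus /opp /=; ring_simplify (t + h + - t).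
Qed.

Lemma is_velocity_RtoC (h : R -> R) t l : is_derive h t l ->
  is_velocity (fun s => RtoC (h s)) t (RtoC l).
Proof.
case=> _ H; split; first exact: is_linear_scal_l.
move=> x Hx eps; apply: filter_imp (H x Hx eps) => s.
rewrite norm_C_R => Hs; apply: Rle_trans Hs; apply: Req_le.
rewrite -[norm _]/(Rabs _) -Cmod_R; congr Cmod.
by apply: injective_projections; rewrite /= /plus /= /opp /= /scal /= /mult /= /minus /plus
  /opp /=; ring.
Qed.

Lemma is_velocity_pair g t v : is_derive (fun s => (g s).1) t v.1 ->
  is_derive (fun s => (g s).2) t v.2 -> is_velocity g t v.
Proof.
move=> /is_velocity_RtoC H1 /is_velocity_RtoC H2.
have := is_velocity_plus H1 (is_velocity_scal Ci H2).
have E (z : C) : (RtoC z.1 + Ci * RtoC z.2)%C = z.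
  by apply: injective_projections => /=; ring.
by rewrite E; apply: is_velocity_ext => s.
Qed.

Lemma derive0_const (f : R -> R) a b : a <= b ->
  continuous_on (fun t => a <= t <= b) f ->
  (forall t, a < t < b -> is_derive f t 0) -> f b = f a.
Proof.
move=> ab Cf Df.
have := @MVT_gen (fun s => f (clamp a b s)) a b (fun _ => 0).
rewrite Rmin_left // Rmax_right //= => H.
have [||c [_]] := H.
- move=> x xab; apply: (is_derive_ext_loc f); last exact: Df.
  have d0 : 0 < Rmin (x - a) (b - x) by apply: Rmin_pos; lra.
  exists (mkposreal _ d0) => y /Rabs_lt_between' /= yx.
  have := Rmin_l (x - a) (b - x); have := Rmin_r (x - a) (b - x) => ? ?.
  by rewrite clamp_id //; lra.
- by move=> x _; apply/continuity_pt_filterlim; apply: continuous_clamp.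
- by rewrite !clamp_id; [lra|lra|lra].
Qed.

(** A listed point inside (a, b) cuts the segment in two, and continuity at that point joins the two
    constant values. In the applications the list holds the corners of the path. *)
Lemma velocity0_const (f : R -> C) a b (l : list R) : a <= b ->
  continuous_on (fun t => a <= t <= b) f ->
  (forall t, a < t < b -> ~ List.In t l -> is_velocity f t 0) -> f b = f a.
Proof.
elim: l a b => [|x l IH] a b ab Cf Df.
  have D t : a < t < b -> is_velocity f t 0 by move=> tab; apply: Df => // [[]].
  apply: injective_projections; apply: (@derive0_const (fun s => _ (f s))) => //.
  - by move=> t tab; apply: filterlim_Cfst; apply: Cf.
  - by move=> t tab; exact: (is_velocity_fst (D t tab)).
  - by move=> t tab; apply: filterlim_Csnd; apply: Cf.
  - by move=> t tab; exact: (is_velocity_snd (D t tab)).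
have sub u v : a <= u -> v <= b -> (x <= u \/ v <= x) -> u <= v -> f v = f u.
  move=> au vb xuv uv; apply: IH => //.
    by apply: continuous_on_subset Cf => t; lra.
  by move=> t tuv tl; apply: Df; [lra | case=> // ?; lra].
case: (Rle_dec x a) => xa; first by apply: sub => //; lra.
case: (Rle_dec b x) => xb; first by apply: sub => //; lra.
by rewrite (sub x b) ?(sub a x) //; lra.
Qed.

(** * Transport as a triangular system of equations *)

(** [omega] lives in degree one, so the equation is triangular: the coefficient of a word is driven
    by that of the word without its last letter. The initial value is left out because solutions
    starting at other series, such as [local_solution], are compared too. *)
Definition is_flow (m : nat) (g : R -> C) (a b : R) (Phi : R -> ncseries m) : Prop :=
  (forall w, continuous_on (fun t => a <= t <= b) (fun t => Phi t w)) /\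
  forall t v, a < t < b -> is_velocity g t v ->
    is_velocity (fun s => Phi s [::]) t 0 /\
    forall w x, is_velocity (fun s => Phi s (rcons w x)) t
      (v * (Phi t w * omega m (g t) [:: x]))%C.

Lemma omega_size m z w : size w != 1%N -> omega m z w = 0.
Proof. by case: w => [//|[i|] [|]]. Qed.

Lemma ncmul_omega_nil m (S : ncseries m) z : ncmul S (omega m z) [::] = 0.
Proof. by rewrite /ncmul big_ord_recl big_ord0 /= Cmult_0_r Cplus_0_l. Qed.

Lemma ncmul_omega_rcons m (S : ncseries m) z w x :
  ncmul S (omega m z) (rcons w x) = (S w * omega m z [:: x])%C.
Proof.
rewrite /ncmul; have lt : (size w < (size (rcons w x)).+1)%N by rewrite size_rcons ltnW.
rewrite (bigD1 (Ordinal lt)) //= big1 => [|i].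
  by rewrite -cats1 take_size_cat // drop_size_cat // Cplus_0_r.
rewrite -val_eqE; case: i => i /= Hi ne; rewrite omega_size ?Cmult_0_r //.
have ki : (i <= (size w).+1)%N by rewrite -ltnS -(size_rcons w x).
rewrite size_drop size_rcons; apply: contra ne => /eqP E.
by have := subKn ki; rewrite E subn1 /= => ->.
Qed.

Lemma solves_transport_flow m g a b (Phi : R -> ncseries m) :
  solves_transport g a b Phi <-> is_flow g a b Phi /\ forall w, Phi a w = nc1 w.
Proof.
split.
- move=> H; split; last by move=> w; case: (H w).
  split=> [w|t v tab vt]; first by case: (H w) => _ [].
  split=> [|w x].
    case: (H [::]) => _ [_ /(_ t v tab vt)].
    by rewrite ncmul_omega_nil Cmult_0_r.
  by case: (H (rcons w x)) => _ [_ /(_ t v tab vt)]; rewrite ncmul_omega_rcons.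
- case=> [[HC HD] H0] w; split; first exact: H0.
  split=> [|t v tab vt]; first exact: HC.
  have [Dn Dr] := HD t v tab vt; case: (lastP w) => [|w' x].
    by rewrite ncmul_omega_nil Cmult_0_r.
  by rewrite ncmul_omega_rcons.
Qed.

(** Induction on the word from its right end: the two velocities at [rcons w x] differ by a multiple
    of the difference at [w], which vanishes by induction. *)
Lemma flow_unique m g a b l (Phi Psi : R -> ncseries m) : a <= b ->
  (forall t, a < t < b -> ~ List.In t l -> exists v, is_velocity g t v) ->
  is_flow g a b Phi -> is_flow g a b Psi -> (forall w, Phi a w = Psi a w) ->
  forall w t, a <= t <= b -> Phi t w = Psi t w.
Proof.
move=> ab Hl [C1 D1] [C2 D2] H0.
have key w t : a <= t <= b -> (forall s, a < s < t -> ~ List.In s l ->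
    is_velocity (fun s => Phi s w - Psi s w)%C s 0) -> Phi t w = Psi t w.
  move=> tab H; have := @velocity0_const _ a t l (proj1 tab) _ H.
  rewrite (H0 w) => E; replace (Phi t w) with (Phi t w - Psi t w + Psi t w)%C by ring.
  rewrite E; first by ring.
  have sub (f : R -> C) : continuous_on (fun t => a <= t <= b) f ->
      continuous_on (fun s => a <= s <= t) f.
    by apply: continuous_on_subset => s; lra.
  by move=> s sat; apply: filterlim_Cminus; [exact: (sub _ (C1 w)) | exact: (sub _ (C2 w))].
have diff f h s v : is_velocity f s v -> is_velocity h s v ->
    is_velocity (fun s => f s - h s)%C s 0.
  move=> /is_velocity_plus E /(is_velocity_scal (RtoC (-1))) /E.
  replace (v + RtoC (-1) * v)%C with (RtoC 0) by ring.
  by apply: is_velocity_ext => r; ring.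
elim/last_ind => [|w x IH] t tab; apply: key => // s sat sl;
  (have [|v Hv] := Hl s _ sl; first lra).
  have [|E1 _] := D1 s v _ Hv; first lra; have [|E2 _] := D2 s v _ Hv; first lra.
  exact: diff E1 E2.
have [|_ /(_ w x) E1] := D1 s v _ Hv; first lra.
have [|_ /(_ w x) E2] := D2 s v _ Hv; first lra.
by apply: diff E1 _; rewrite IH //; lra.
Qed.

Lemma transport_eq m g a b l (Phi : R -> ncseries m) w : a <= b ->
  (forall t, a < t < b -> ~ List.In t l -> exists v, is_velocity g t v) ->
  solves_transport g a b Phi -> transport m g a b w = Phi b w.
Proof.
move=> ab Hl HPhi; apply: iota_unique; last by exists Phi.
move=> c [Psi [/solves_transport_flow[FPsi P0] ->]].
case/solves_transport_flow: HPhi => FPhi P0'.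
apply: (flow_unique ab Hl FPsi FPhi) => [w'|]; last lra.
by rewrite P0 P0'.
Qed.

(** * Existence of the transport along piecewise smooth paths *)

(** The zeros may accumulate at [t] from one side only. This is what identifies the velocity of a
    path at a knot with the derivative of each adjacent C^1 extension. *)
Lemma velocity_zero f t w : is_velocity f t w -> f t = 0 ->
  (forall d, 0 < d -> exists s, 0 < Rabs (s - t) < d /\ f s = 0) -> w = 0.
Proof.
case/is_velocityP=> q [/filterlim_CP Hq _ Hf] ft0 H.
apply: Cmod_eq_0; apply: Rle_antisym; last exact: Cmod_ge_0.
apply: Rnot_lt_le => w0; have [d Hd] := Hq _ w0.
have [s [[s0 sd] fs]] := H d (cond_pos d).
have := Hd s sd; have -> : q s = 0.
  have := Hf s; rewrite fs ft0 Cplus_0_l => /esym E.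
  have n0 : RtoC (s - t) <> 0 by case=> E'; move: s0; rewrite E' Rabs_R0; lra.
  replace (q s) with (RtoC (s - t) * q s / RtoC (s - t))%C by (field; exact: n0).
  by rewrite E /Cdiv Cmult_0_l.
by rewrite /Cminus Cplus_0_l Cmod_opp; lra.
Qed.

Lemma velocity_agree g h t v w : is_velocity g t v -> is_velocity h t w -> g t = h t ->
  (forall d, 0 < d -> exists s, 0 < Rabs (s - t) < d /\ g s = h s) -> v = w.
Proof.
move=> Hg Hh E H; have := is_velocity_plus Hg (is_velocity_scal (RtoC (-1)) Hh).
move=> /velocity_zero Z; replace v with (v + RtoC (-1) * w + w)%C by ring.
rewrite Z; first by ring.
  by rewrite E; ring.
by move=> d /H [s [sd Es]]; exists s; split=> //; rewrite Es; ring.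
Qed.

Section Piecewise.

Variables (g : R -> C) (k : nat) (tau : nat -> R).
Hypotheses (tau0 : tau 0%N = 0) (tauk : tau k = 1).
Hypothesis pieces : forall i, (i < k)%N ->
  tau i < tau i.+1 /\ C1_on (tau i) (tau i.+1) g.

Lemma piece_left t n : (n <= k)%N -> 0 < t <= tau n ->
  exists2 i, (i < k)%N & tau i < t <= tau i.+1.
Proof.
elim: n => [|n IH] nk t0n; first lra.
case: (Rle_dec t (tau n)) => tn; first by apply: IH; [exact: ltnW | lra].
by exists n => //; lra.
Qed.

Lemma piece_right t n : (n <= k)%N -> 0 <= t < tau n ->
  exists2 i, (i < k)%N & tau i <= t < tau i.+1.
Proof.
elim: n => [|n IH] nk t0n; first lra.
case: (Rlt_dec t (tau n)) => tn; first by apply: IH; [exact: ltnW | lra].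
by exists n => //; lra.
Qed.

Lemma velocity_eq_on (h h' : R -> C) a b t : (forall t, is_velocity h t (h' t)) ->
  (forall t, a <= t <= b -> g t = h t) -> a < t < b -> is_velocity g t (h' t).
Proof.
move=> Dh E tab; apply: is_velocity_ext_loc (Dh t).
have d0 : 0 < Rmin (t - a) (b - t) by apply: Rmin_pos; lra.
exists (mkposreal _ d0) => y /Rabs_lt_between' /= yx.
have := Rmin_l (t - a) (b - t); have := Rmin_r (t - a) (b - t) => ? ?.
by rewrite E //; lra.
Qed.

Lemma pieces_velocity t : 0 < t < 1 -> ~ List.In t (List.map tau (List.seq 0 k.+1)) ->
  exists v, is_velocity g t v.
Proof.
move=> t01 nt; have [|i ik ti] := @piece_left t k (leqnn _); first lra.
have [_ [h [h' [Dh [_ E]]]]] := pieces ik; exists (h' t).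
apply: velocity_eq_on Dh E _; split; first lra.
case: (Req_dec t (tau i.+1)) => [E'|]; last lra.
case: nt; rewrite E'; apply: List.in_map; apply/List.in_seq; split; first exact/leP.
by apply/ltP.
Qed.

Lemma knots_in n : (n <= k)%N -> 0 <= tau n <= 1.
Proof.
move=> nk; split.
  elim: n nk => [|n IH] nk; first lra.
  by have [? _] := pieces nk; have := IH (ltnW nk); lra.
(* Descending induction from [tau k] = 1, with [n] written as k - d; for d >= k truncated
   subtraction makes both indices 0. *)
rewrite -tauk -(subKn nk); elim: (k - n)%N => [|d IH]; first by rewrite subn0; lra.
case: (ltnP d k) => [dk|kd]; last by rewrite (eqP (leqW kd : k - d.+1 == 0)%N) -(eqP (kd : k
  - d == 0)%N).
have lt : (k - d.+1 < k)%N by rewrite ltn_subrL /= (leq_ltn_trans _ dk).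
have [? _] := pieces lt; move: IH; rewrite -(subnSK dk); lra.
Qed.

Lemma pieces_continuous_on : continuous_on (fun t => 0 <= t <= 1) g.
Proof.
rewrite -tauk -tau0; have: (k <= k)%N by []; elim: {-2}k => [_|n IH nk].
  move=> t t0 P HP; have {}t0 : t = tau 0%N by lra.
  exists (mkposreal _ Rlt_0_1) => y _ y0; have -> : y = t by lra.
  exact: locally_singleton.
apply: (@continuous_on_glue _ _ _ (tau n)); first by apply: IH; exact: ltnW.
have [_ [h [h' [Dh [Ch E]]]]] := pieces nk.
apply: (continuous_on_ext _ h) => [t tn|]; first by rewrite E.
apply: continuous_on_forall => t _; exact: (is_velocity_continuous (Dh t)).
Qed.

(* The extension by [0] makes primitives available on the whole line, so that no
   one-sided continuity is needed at the end points. *)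
Definition vel (t : R) : C :=
  if excluded_middle_informative (0 < t < 1)
  then Hierarchy.iota (T := C_R_CompleteNormedModule) (is_velocity g t) else RtoC 0.

Lemma vel_eq t v : 0 < t < 1 -> is_velocity g t v -> vel t = v.
Proof.
move=> t01 Hv; rewrite /vel; case: (excluded_middle_informative _) => // _ /=.
apply: iota_unique => // y Hy; exact: is_velocity_unique Hy Hv.
Qed.

(** A knot at which the path happens to be differentiable is included: the C^1 extensions on its
    left and on its right both have derivative [v] there, and [vel] coincides with one of them on
    each side of [t]. *)
Lemma vel_continuous t v : 0 < t < 1 -> is_velocity g t v -> continuous vel t.
Proof.
move=> t01 Hv.
have [|i ik ti] := @piece_left t k (leqnn _); first lra.
have [|j jk tj] := @piece_right t k (leqnn _); first lra.
have [_ [h1 [h1' [Dh1 [Ch1 E1]]]]] := pieces ik.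
have [_ [h2 [h2' [Dh2 [Ch2 E2]]]]] := pieces jk.
have e1 : h1' t = v.
  symmetry; apply: velocity_agree Hv (Dh1 t) (E1 _ _) _; first lra.
  move=> d d0; exists (t - Rmin (d / 2) (t - tau i)).
  have : 0 < Rmin (d / 2) (t - tau i) by apply: Rmin_pos; lra.
  have := Rmin_l (d / 2) (t - tau i); have := Rmin_r (d / 2) (t - tau i) => ? ? ?.
  split; first by split_Rabs; lra.
  by apply: E1; lra.
have e2 : h2' t = v.
  symmetry; apply: velocity_agree Hv (Dh2 t) (E2 _ _) _; first lra.
  move=> d d0; exists (t + Rmin (d / 2) (tau j.+1 - t)).
  have : 0 < Rmin (d / 2) (tau j.+1 - t) by apply: Rmin_pos; lra.
  have := Rmin_l (d / 2) (tau j.+1 - t); have := Rmin_r (d / 2) (tau j.+1 - t) => ? ? ?.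
  split; first by split_Rabs; lra.
  by apply: E2; lra.
apply/filterlim_CP => eps eps0; rewrite (vel_eq t01 Hv).
have /filterlim_CP/(_ eps eps0) := Ch1 t; rewrite e1 => L1.
have /filterlim_CP/(_ eps eps0) := Ch2 t; rewrite e2 => L2.
have d0 : 0 < Rmin (Rmin t (1 - t)) (Rmin (t - tau i) (tau j.+1 - t)).
  by apply: Rmin_pos; apply: Rmin_pos; lra.
apply: (filter_imp _ _ _ (filter_and _ _ (locally_ball t (mkposreal _ d0)) (filter_and _ _
  L1 L2))) => s [/Rabs_lt_between' /= st [s1 s2]].
have := Rmin_l (Rmin t (1 - t)) (Rmin (t - tau i) (tau j.+1 - t)).
have := Rmin_r (Rmin t (1 - t)) (Rmin (t - tau i) (tau j.+1 - t)) => m1 m2.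
have := Rmin_l t (1 - t); have := Rmin_r t (1 - t) => ? ?.
have := Rmin_l (t - tau i) (tau j.+1 - t); have := Rmin_r (t - tau i) (tau j.+1 - t) => ? ?.
have s01 : 0 < s < 1 by lra.
case: (Rtotal_order s t) => [lt|[->|gt]].
- have -> // : vel s = h1' s; apply: vel_eq => //.
  by apply: velocity_eq_on Dh1 E1 _; lra.
- by rewrite (vel_eq t01 Hv); replace (v - v)%C with (RtoC 0); [rewrite Cmod_0|ring].
- have -> // : vel s = h2' s; apply: vel_eq => //.
  by apply: velocity_eq_on Dh2 E2 _; lra.
Qed.

Notation ex_CInt := (ex_RInt (V := C_R_CompleteNormedModule)).

Lemma ex_RInt_vel (c : R -> C) x y : (forall t, continuous c t) ->
  ex_CInt (fun t => c t * vel t)%C x y.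
Proof.
move=> Cc.
have zero u v : v <= 0 \/ 1 <= u -> u <= v -> ex_CInt (fun t => c t * vel t)%C u v.
  move=> out uv; apply: (ex_RInt_ext (fun _ => RtoC 0)); last exact: ex_RInt_const.
  rewrite Rmin_left // Rmax_right // => t tuv; rewrite /vel.
  by case: (excluded_middle_informative _) => [?|_] /=; [lra | rewrite Cmult_0_r].
have unit : ex_CInt (fun t => c t * vel t)%C 0 1.
  rewrite -tauk -tau0; have: (k <= k)%N by []; elim: {-2}k => [_|n IH nk].
    exact: ex_RInt_point.
  apply: (ex_RInt_Chasles _ _ (tau n)); first by apply: IH; exact: ltnW.
  have [lt [h [h' [Dh [Ch E]]]]] := pieces nk.
  (* The integrands are compared on the open piece only, so the value of [vel] at a knot is
     harmless. *)
  apply: (ex_RInt_ext (fun t => c t * h' t)%C); last first.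
    apply: (ex_RInt_continuous (V := C_R_CompleteNormedModule)) => t _;
      apply: filterlim_Cmult; [exact: Cc | exact: Ch].
  rewrite Rmin_left ?Rmax_right; [|lra|lra] => t tn; congr Cmult.
  have := knots_in nk; have := knots_in (ltnW nk) => ? ?.
  symmetry; apply: vel_eq; first lra.
  by apply: velocity_eq_on Dh E _.
(* The segment [-M, M] contains [x], [y] and [0, 1]; integrability is inherited by its
   subintervals. *)
pose M := 1 + Rabs x + Rabs y.
have /Rabs_le_between ? : Rabs x <= M by rewrite /M; have := Rabs_pos y; lra.
have /Rabs_le_between ? : Rabs y <= M by rewrite /M; have := Rabs_pos x; lra.
have M1 : 1 <= M by rewrite /M; have := Rabs_pos x; have := Rabs_pos y; lra.
have big : ex_CInt (fun t => c t * vel t)%C (- M) M.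
  apply: (ex_RInt_Chasles _ _ 0); first by apply: zero; lra.
  by apply: (ex_RInt_Chasles _ _ 1) => //; apply: zero; lra.
have from u : - M <= u <= M -> ex_CInt (fun t => c t * vel t)%C (- M) u.
  by move=> uM; apply: (ex_RInt_Chasles_1 _ _ _ M).
apply: (ex_RInt_Chasles _ _ (- M)); last exact: from.
by apply: ex_RInt_swap; exact: from.
Qed.

Lemma is_velocity_RInt_vel (c : R -> C) a t v : (forall t, continuous c t) ->
  0 < t < 1 -> is_velocity g t v ->
  is_velocity (fun s => RInt (V := C_R_CompleteNormedModule) (fun r => c r * vel r)%C a s) t
    (c t * v)%C.
Proof.
move=> Cc t01 Hv; rewrite -(vel_eq t01 Hv).
apply: (is_derive_RInt (V := C_R_NormedModule) (fun r => c r * vel r)%C _ a).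
  by apply: filter_forall => s; apply: (RInt_correct (V := C_R_CompleteNormedModule));
    exact: ex_RInt_vel.
by apply: filterlim_Cmult; [exact: Cc | exact: vel_continuous Hv].
Qed.

Lemma continuous_RInt_vel (c : R -> C) a t : (forall t, continuous c t) ->
  continuous (fun s => RInt (V := C_R_CompleteNormedModule) (fun r => c r * vel r)%C a s) t.
Proof.
move=> Cc; apply: (continuous_RInt_1 (V := C_R_NormedModule) (fun r => c r * vel r)%C a).
by apply: filter_forall => s; apply: (RInt_correct (V := C_R_CompleteNormedModule));
  exact: ex_RInt_vel.
Qed.

End Piecewise.

Lemma piecewise_velocity g : piecewise_C1 g ->
  exists l, forall t, 0 < t < 1 -> ~ List.In t l -> exists v, is_velocity g t v.
Proof.
case=> k [tau [t0 [t1 H]]]; exists (List.map tau (List.seq 0 k.+1)) => t.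
exact: pieces_velocity t0 t1 H t.
Qed.

Lemma piecewise_continuous_on g : piecewise_C1 g -> continuous_on (fun t => 0 <= t <= 1) g.
Proof. by case=> k [tau [t0 [t1 H]]]; exact: pieces_continuous_on t0 t1 H. Qed.

(** * Roots of unity, regularity of the form on the curve, and iterated integrals *)

Lemma zeta_pow m i : (0 < m)%N ->
  Cpow (zeta m) i = (cos (INR i * (2 * PI / INR m)), sin (INR i * (2 * PI / INR m))).
Proof.
move=> m0; elim: i => [|i IH]; first by rewrite /= !Rmult_0_l cos_0 sin_0.
rewrite Cpow_S IH S_INR Rmult_plus_distr_r Rmult_1_l Rplus_comm cos_plus sin_plus /zeta /Cmult /=.
by congr pair; ring.
Qed.

Lemma INR_neq0 m : (0 < m)%N -> INR m <> 0.
Proof. by move=> m0; apply: not_0_INR => E; rewrite E in m0. Qed.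

Lemma zeta_pow_self m : (0 < m)%N -> Cpow (zeta m) m = 1.
Proof.
move=> m0; rewrite zeta_pow //; have := INR_neq0 m0 => n0.
replace (INR m * (2 * PI / INR m)) with (2 * PI) by (field; exact: n0).
by rewrite cos_2PI sin_2PI.
Qed.

Lemma Cmod_zeta_pow m i : (0 < m)%N -> Cmod (Cpow (zeta m) i) = 1.
Proof.
move=> m0; rewrite zeta_pow // /Cmod /=.
rewrite -[RHS]sqrt_1; congr sqrt; rewrite !Rmult_1_r Rplus_comm; exact: sin2_cos2.
Qed.

Lemma V_minus_zeta m z i : (0 < m)%N -> V m z -> (z - Cpow (zeta m) i)%C <> 0.
Proof.
move=> m0 [_ Vz] E; apply: Vz.
have -> : z = Cpow (zeta m) i.
  by replace z with (z - Cpow (zeta m) i + Cpow (zeta m) i)%C by ring; rewrite E Cplus_0_l.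
by rewrite -Cpow_mult_r PeanoNat.Nat.mul_comm Cpow_mult_r zeta_pow_self // Cpow_1_l.
Qed.

Lemma filterlim_omega m z x : (0 < m)%N -> V m z ->
  filterlim (fun y => omega m y [:: x]) (locally z) (locally (omega m z [:: x])).
Proof.
move=> m0 Vz; case: x => [i|] /=; apply: filterlim_Cinv.
- exact: V_minus_zeta.
- by apply: filterlim_Cminus; [exact: filterlim_id | exact: filterlim_Cconst].
- by case: Vz.
- exact: filterlim_id.
Qed.

(** The coefficients are iterated integrals along [g]. Where [g] has no velocity they are known only
    to be continuous, which is all that [solves_transport] asks for at such times. *)
Lemma transport_exists m g e : (0 < m)%N -> piecewise_C1 g ->
  (forall t, 0 < t <= 1 -> V m (g t)) -> 0 < e < 1 ->
  exists Phi, solves_transport (m := m) g e 1 Phi.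
Proof.
move=> m0 [k [tau [t0 [t1 H]]]] Vg e01.
(* [clamp] keeps the path on [e, 1], away from the pole at 0, and makes [q x] continuous on the
   whole line. *)
pose q x t := omega m (g (clamp e 1 t)) [:: x].
have e1 : e <= 1 by lra.
have Cq x t : continuous (q x) t.
  have Vt : V m (g (clamp e 1 t)) by apply: Vg; have := clamp_in t e1; lra.
  apply: (filterlim_comp _ _ _ (fun s => g (clamp e 1 s)) (fun y => omega m y [:: x])); last first.
    exact: filterlim_omega.
  apply: (@continuous_clamp _ g) => //.
  apply: continuous_on_subset (pieces_continuous_on t0 t1 H) => s; lra.
(* The last letter of a word is integrated last, so [P] recurses on reversed words. *)
pose P := fix P (u : word m) : R -> C := match u with
  | [::] => fun _ => RtoC 1
  | x :: u' => fun t => RInt (V := C_R_CompleteNormedModule)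
      (fun s => (P u' s * q x s) * vel g s)%C e t end.
have CP u t : continuous (P u) t.
  elim: u t => [|x u IH] t; first exact: filterlim_Cconst.
  apply: (continuous_RInt_vel t0 t1 H (c := fun s => (P u s * q x s)%C)) => s.
  by apply: filterlim_Cmult; [exact: IH | exact: Cq].
exists (fun t w => P (rev w) t); apply/solves_transport_flow; split; [split|].
- by move=> w; apply: continuous_on_forall => t _; exact: CP.
- move=> t v te Hv; split; first exact: is_velocity_const.
  move=> w x; rewrite rev_rcons.
  have := is_velocity_RInt_vel t0 t1 H (c := fun s => (P (rev w) s * q x s)%C) e (t := t) (v := v).
  have -> : omega m (g t) [:: x] = q x t by rewrite /q clamp_id //; lra.
  replace (v * (P (rev w) t * q x t))%C with (P (rev w) t * q x t * v)%C by ring.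
  apply=> //; last lra.
  by move=> s; apply: filterlim_Cmult; [exact: CP | exact: Cq].
- move=> w; case: (lastP w) => [//|w' x]; rewrite rev_rcons /= RInt_point.
  by case: w'.
Qed.

(** * Algebra of non-commutative series *)

Lemma ncmul_nil m (S T : ncseries m) : ncmul S T [::] = (S [::] * T [::])%C.
Proof. by rewrite /ncmul big_ord_recl big_ord0 /= Cplus_0_r. Qed.

Lemma ncmul_cons m (S T : ncseries m) a w :
  ncmul S T (a :: w) = (S [::] * T (a :: w) + ncmul (fun u => S (a :: u)) T w)%C.
Proof. by rewrite /ncmul big_ord_recl. Qed.

Lemma ncmul_rcons m (S T : ncseries m) w a :
  ncmul S T (rcons w a) = (ncmul S (fun u => T (rcons u a)) w + S (rcons w a) * T [::])%C.
Proof.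
rewrite /ncmul size_rcons big_ord_recr /=; congr Cplus.
  apply: eq_bigr => [[i /= Hi] _]; rewrite -cats1 takel_cat // drop_cat.
  case: ltnP => [_|ge]; first by rewrite cats1.
  have -> : i = size w by apply/eqP; rewrite eqn_leq ge andbT.
  by rewrite subnn drop0 drop_size.
by rewrite -(size_rcons w a) take_size drop_size.
Qed.

Lemma eq_ncmul m (S S' T T' : ncseries m) w :
  S =1 S' -> T =1 T' -> ncmul S T w = ncmul S' T' w.
Proof. by move=> ES ET; apply: eq_bigr => i _; rewrite ES ET. Qed.

Lemma ncmul_linearl m c (S S' T : ncseries m) w :
  ncmul (fun u => (c * S u + S' u)%C) T w = (c * ncmul S T w + ncmul S' T w)%C.
Proof.
rewrite /ncmul big_distrr -big_split; apply: eq_bigr => i _ /=.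
by rewrite Cmult_plus_distr_r Cmult_assoc.
Qed.

Lemma ncmul_suml m (I : finType) (P : pred I) (S : I -> ncseries m) (T : ncseries m) w :
  ncmul (fun u => \big[Cplus/RtoC 0]_(i | P i) S i u) T w =
  \big[Cplus/RtoC 0]_(i | P i) ncmul (S i) T w.
Proof.
rewrite /ncmul exchange_big /=; apply: eq_bigr => k _.
by rewrite big_distrl.
Qed.

(** Removing the first letter of the word replaces the left factor by a shifted series
    ([ncmul_cons]); the two sides then match by linearity in the left factor. *)
Lemma ncmulA m (S T U : ncseries m) w :
  ncmul S (ncmul T U) w = ncmul (ncmul S T) U w.
Proof.
elim: w S T => [|a w IH] S T; first by rewrite !ncmul_nil Cmult_assoc.
rewrite !ncmul_cons IH ncmul_nil.
have -> : ncmul (fun u => ncmul S T (a :: u)) U w =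
    ncmul (fun u => (S [::] * T (a :: u) + ncmul (fun u => S (a :: u)) T u)%C) U w.
  by apply: eq_ncmul => // u; rewrite ncmul_cons.
by rewrite ncmul_linearl; ring.
Qed.

Lemma ncmul1l m (S : ncseries m) w : ncmul nc1 S w = S w.
Proof.
case: w => [|a w]; first by rewrite ncmul_nil Cmult_1_l.
rewrite ncmul_cons Cmult_1_l /ncmul big1 ?Cplus_0_r // => i _.
by rewrite Cmult_0_l.
Qed.

Lemma RtoC_neq0 x : x <> 0 -> RtoC x <> 0.
Proof. by move=> x0 []. Qed.

(** * Divided powers and the exponential of a multiple of X *)

Definition divpow (c : C) (k : nat) : C := Cdiv (Cpow c k) (RtoC (INR k`!)).

Lemma divpowS c k : (RtoC (INR k.+1) * divpow c k.+1)%C = (c * divpow c k)%C.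
Proof.
rewrite /divpow factS -multE mult_INR RtoC_mult Cpow_S.
have h1 := INR_neq0 (fact_gt0 k); have h2 := INR_neq0 (ltn0Sn k).
by field; split; case.
Qed.

(** The binomial theorem without binomial coefficients: multiply by k + 1 = i + (k + 1 - i) and
    lower one of the two divided powers in each part by [divpowS]. *)
Lemma divpow_sum a b k :
  \big[Cplus/RtoC 0]_(i < k.+1) (divpow a i * divpow b (k - i))%C = divpow (a + b)%C k.
Proof.
elim: k => [|k IH].
  rewrite big_ord_recl big_ord0 /divpow /= /Cdiv; field; by case; lra.
have n0 : RtoC (INR k.+1) <> 0 by apply: RtoC_neq0; exact: INR_neq0.
set s := LHS; suff E : (RtoC (INR k.+1) * s = RtoC (INR k.+1) * divpow (a + b) k.+1)%C.
  replace s with (RtoC (INR k.+1) * s / RtoC (INR k.+1))%C by (field; exact: n0).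
  by rewrite E; field.
rewrite divpowS -IH Cmult_plus_distr_r {}/s big_distrr /=.
have split_term (i : 'I_k.+2) : (RtoC (INR k.+1) * (divpow a i * divpow b (k.+1 - i)) =
    RtoC (INR i) * divpow a i * divpow b (k.+1 - i) +
    divpow a i * (RtoC (INR (k.+1 - i)) * divpow b (k.+1 - i)))%C.
  have -> : INR k.+1 = INR i + INR (k.+1 - i).
    by rewrite -plus_INR plusE subnKC // -ltnS.
  by rewrite RtoC_plus; ring.
rewrite (eq_bigr _ (fun i _ => split_term i)) big_split /=; congr Cplus.
- rewrite big_ord_recl /= !Cmult_0_l Cplus_0_l big_distrr /=.
  by apply: eq_bigr => i _; rewrite /bump add1n -/(INR i.+1) divpowS subSS Cmult_assoc.
- rewrite big_ord_recr /= subnn /= Cmult_0_l Cmult_0_r Cplus_0_r big_distrr /=.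
  apply: eq_bigr => i _; rewrite subSn ?divpowS; last by rewrite -ltnS.
  by ring.
Qed.

Lemma ncexpXE m c (w : word m) :
  ncexpX c w = if all (pred1 letterX) w then divpow c (size w) else RtoC 0.
Proof. by []. Qed.

Lemma ncexpXD m a b (w : word m) :
  ncmul (ncexpX a) (ncexpX b) w = ncexpX (a + b)%C w.
Proof.
rewrite [RHS]ncexpXE; case Hw: (all _ w).
  rewrite -divpow_sum; apply: eq_bigr => [[i /= Hi] _].
  move: Hw; rewrite -{1}(cat_take_drop i w) all_cat !ncexpXE => /andP[-> ->].
  by rewrite size_drop size_takel // -ltnS.
rewrite /ncmul big1 // => i _; rewrite !ncexpXE.
move: Hw; rewrite -{1}(cat_take_drop i w) all_cat.
by case: (all _ _) => /= [->|_]; rewrite ?Cmult_0_r ?Cmult_0_l.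
Qed.

Lemma ncexpX0 m (w : word m) : ncexpX 0 w = nc1 w.
Proof.
rewrite ncexpXE; case: w => [|a w] /=; first by rewrite /divpow /=; field; case; lra.
by case: ifP => // _; rewrite /divpow Cpow_S Cmult_0_l /Cdiv Cmult_0_l.
Qed.

(** The equation multiplies by [omega] on the right, so a constant factor on the left preserves it.
    This is how the initial value of a solution is changed. *)
Lemma is_flow_ncmul m g a b (A : ncseries m) Phi : is_flow g a b Phi ->
  is_flow g a b (fun t => ncmul A (Phi t)).
Proof.
case=> HC HD; split.
- move=> w t tab; apply: filterlim_Csum => i; apply: filterlim_Cmult.
    exact: filterlim_Cconst.
  exact: HC.
- move=> t v tab Hv; have [D0 D1] := HD t v tab Hv; split=> [|w x].
    have := is_velocity_scal (A [::]) D0; rewrite Cmult_0_r.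
    by apply: is_velocity_ext => s; rewrite ncmul_nil.
  (* The cut after the last letter pairs with the coefficient of the empty word, whose velocity is
     0; all other cuts keep [x] in the right factor. *)
  have H0 := is_velocity_scal (A (rcons w x)) D0.
  have H1 := @is_velocity_sum _ (index_enum 'I_(size w).+1) xpredT
    (fun k s => A (take k w) * Phi s (rcons (drop k w) x))%C _ t
    (fun k => is_velocity_scal (A (take k w)) (D1 (drop k w) x)).
  have := is_velocity_plus H1 H0; rewrite Cmult_0_r Cplus_0_r.
  have -> : (v * (ncmul A (Phi t) w * omega m (g t) [:: x]) =
    \big[Cplus/RtoC 0]_(i < (size w).+1)
      (A (take i w) * (v * (Phi t (drop i w) * omega m (g t) [:: x]))))%C.
    rewrite /ncmul big_distrl big_distrr; apply: eq_bigr => i _ /=; ring.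
  by apply: is_velocity_ext => s; rewrite ncmul_rcons.
Qed.

(** * Push-forward of series along the reduction of words *)

Section SumLift.

Variables r n : nat.
Implicit Types (S T : ncseries (r * n)) (w : word r).

(** The sum over the words that reduce to [w], organised letter by letter to allow induction on [w];
    [sumlift_tuple] recovers the sum over tuples of the theorem. *)
Fixpoint sumlift S w : C :=
  if w is x :: w' then
    \big[Cplus/RtoC 0]_(b : letter (r * n) | letter_mod b == x) sumlift (fun u => S (b :: u)) w'
  else S [::].

Lemma eq_sumlift S T w : S =1 T -> sumlift S w = sumlift T w.
Proof.
elim: w S T => [|x w IH] S T E /=; first exact: E.
by apply: eq_bigr => b _; apply: IH => u; rewrite E.
Qed.

Lemma sumlift_tuple S w :
  \big[Cplus/RtoC 0]_(u : (size w).-tuple (letter (r * n)) | word_mod (tval u) == w) S (tval u)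
  = sumlift S w.
Proof.
elim: w S => [|x w IH] S /=.
  rewrite (big_pred1 [tuple]) // => u; by rewrite tuple0 /= eqxx.
rewrite (reindex (fun p : letter (r * n) * (size w).-tuple (letter (r * n)) =>
  [tuple of p.1 :: p.2])) /=; last first.
  exists (fun u => (thead u, [tuple of behead u])) => [[b u] _ | u _].
    by congr pair; apply: val_inj.
  by rewrite [u in RHS]tuple_eta.
rewrite (eq_bigl (fun p : letter (r * n) * (size w).-tuple (letter (r * n)) =>
  (letter_mod p.1 == x) && (word_mod p.2 == w))); last first.
  by move=> p; rewrite /word_mod /= eqseq_cons.
rewrite -(pair_big (fun b : letter (r * n) => letter_mod b == x) (fun u : (size w).-tuple
  (letter (r * n)) => word_mod u == w)
  (fun b (u : (size w).-tuple _) => S (b :: u))) /=.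
by apply: eq_bigr => b _; rewrite -IH.
Qed.

Lemma sumlift_linear c S T w :
  sumlift (fun u => (c * S u + T u)%C) w = (c * sumlift S w + sumlift T w)%C.
Proof.
elim: w S T => [|x w IH] S T //=.
by rewrite big_distrr -big_split; apply: eq_bigr => b _; rewrite IH.
Qed.

Lemma sumlift_rcons S w x : sumlift S (rcons w x) =
  \big[Cplus/RtoC 0]_(b : letter (r * n) | letter_mod b == x) sumlift (fun u => S (rcons u b)) w.
Proof.
elim: w S => [|y w IH] S //=.
by rewrite exchange_big; apply: eq_bigr => b _; rewrite IH.
Qed.

(** A lift of a concatenation splits uniquely into lifts of its two parts. *)
Lemma sumlift_mul S T w :
  sumlift (ncmul S T) w = ncmul (sumlift S) (sumlift T) w.
Proof.
elim: w S => [|x w IH] S /=; first by rewrite !ncmul_nil.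
rewrite ncmul_cons /= ncmul_suml big_distrr -big_split; apply: eq_bigr => b _ /=.
rewrite -IH -sumlift_linear; apply: eq_sumlift => u; exact: ncmul_cons.
Qed.

Lemma letter_mod_X (b : letter (r * n)) : (letter_mod b == letterX) = (b == letterX).
Proof. by case: b. Qed.

(** [X] is the only letter above [X], and no letter above a [Y] is an [X]. Quantifying over [F] lets
    the induction shift the length. *)
Lemma sumlift_allX (F : nat -> C) w :
  sumlift (fun u => if all (pred1 letterX) u then F (size u) else RtoC 0) w =
  if all (pred1 letterX) w then F (size w) else RtoC 0.
Proof.
elim: w F => [|[i|] w IH] F //=.
- rewrite big1 // => [[j|]] // _ /=.
  elim: w {IH} => [|x w IH] //=; rewrite big1 // => b _; exact: IH.
- by rewrite (big_pred1 letterX) => [|b]; [rewrite (IH (fun k => F k.+1)) | exact: letter_mod_X].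
Qed.

(** The coefficient at [w] of the image of [S] under the substitution: each [X] of [w] brings a
    factor [n]. *)
Definition push S w : C := (Cpow (RtoC (INR n)) (wtX w) * sumlift S w)%C.

Lemma eq_push S T w : S =1 T -> push S w = push T w.
Proof. by move=> E; rewrite /push (eq_sumlift w E). Qed.

Lemma push_mul S T w : push (ncmul S T) w = ncmul (push S) (push T) w.
Proof.
rewrite /push sumlift_mul /ncmul big_distrr; apply: eq_bigr => k _ /=.
rewrite -{1}(cat_take_drop k w) /wtX count_cat -plusE Cpow_add_r; ring.
Qed.

Lemma push_expX c w : push (ncexpX c) w = ncexpX (RtoC (INR n) * c)%C w.
Proof.
rewrite /push (eq_sumlift (T := fun u => if all (pred1 letterX) u then divpow c (size u)
  else RtoC 0)) //.
rewrite sumlift_allX ncexpXE; case: ifP => [Hw|_]; last by rewrite Cmult_0_r.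
have -> : wtX w = size w by apply/eqP; rewrite -all_count.
by rewrite /divpow Cpow_mult_l /Cdiv Cmult_assoc.
Qed.

Lemma filterlim_sumlift {U : Type} (F : (U -> Prop) -> Prop) {FF : Filter F}
    (S : U -> ncseries (r * n)) T w :
  (forall u, filterlim (fun x => S x u) F (locally (T u))) ->
  filterlim (fun x => sumlift (S x) w) F (locally (sumlift T w)).
Proof.
elim: w S T => [|x w IH] S T H /=; first exact: H.
by apply: filterlim_Csum => b; apply: IH.
Qed.

Lemma filterlim_push {U : Type} (F : (U -> Prop) -> Prop) {FF : Filter F}
    (S : U -> ncseries (r * n)) T w :
  (forall u, filterlim (fun x => S x u) F (locally (T u))) ->
  filterlim (fun x => push (S x) w) F (locally (push T w)).
Proof.
by move=> H; apply: filterlim_Cmult; [exact: filterlim_Cconst | exact: filterlim_sumlift].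
Qed.

Lemma is_velocity_sumlift (S : R -> ncseries (r * n)) T w t :
  (forall u, is_velocity (fun x => S x u) t (T u)) ->
  is_velocity (fun x => sumlift (S x) w) t (sumlift T w).
Proof.
elim: w S T => [|x w IH] S T H /=; first exact: H.
by apply: is_velocity_sum => b; apply: IH.
Qed.

End SumLift.

(** * The cyclic cover *)

Lemma Csum_const k (c : C) : \big[Cplus/RtoC 0]_(i < k) c = (RtoC (INR k) * c)%C.
Proof.
elim: k => [|k IH]; first by rewrite big_ord0 Cmult_0_l.
by rewrite big_ord_recr IH S_INR RtoC_plus /=; ring.
Qed.

Lemma Cpow_sub (y z : C) k : (Cpow y k - Cpow z k)%C =
  ((y - z) * \big[Cplus/RtoC 0]_(l < k) (Cpow y (k.-1 - l) * Cpow z l))%C.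
Proof.
elim: k => [|k IH]; first by rewrite big_ord0 /=; ring.
rewrite big_ord_recr /= subnn.
have -> : \big[Cplus/RtoC 0]_(i < k) (y ^ (k - i) * z ^ i)%C =
    (y * \big[Cplus/RtoC 0]_(l < k) (Cpow y (k.-1 - l) * Cpow z l))%C.
  rewrite big_distrr; apply: eq_bigr => [[i /= Hi] _].
  case: k Hi {IH} => // k Hi; rewrite subSn // Cpow_S /=; ring.
set s := \big[_/_]_(_ <- _ | _) _ in IH *.
replace ((y - z) * (y * s + y ^ 0 * z ^ k))%C with (y * ((y - z) * s) + (y - z) * z ^ k)%C
  by (rewrite /=; ring).
by rewrite -IH; ring.
Qed.

(** With h half the argument, cos (2 h) = 1 forces sin h = 0, which is impossible for 0 < h < pi. *)
Lemma zeta_pow_neq1 m j : (0 < j < m)%N -> Cpow (zeta m) j <> 1.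
Proof.
case/andP=> j0 jm; have m0 := ltn_trans j0 jm.
rewrite zeta_pow //; case=> E _.
have Rm : 0 < INR m by apply: lt_0_INR; apply/ltP.
have Rj : 0 < INR j by apply: lt_0_INR; apply/ltP.
have Rjm : INR j < INR m by apply: lt_INR; apply/ltP.
have PI0 := PI_RGT_0.
pose h := INR j * PI / INR m.
have h0 : 0 < h by apply: Rdiv_lt_0_compat; nra.
have hPI : h < PI.
  apply: (Rmult_lt_reg_r (INR m)) => //; rewrite /h /Rdiv Rmult_assoc Rinv_l; nra.
have := sin_gt_0 h h0 hPI.
move: E; replace (INR j * (2 * PI / INR m)) with (2 * h) by (rewrite /h; field; lra).
rewrite cos_2a_sin => E; nra.
Qed.

Lemma zeta_mul_pow r n : (0 < r)%N -> (0 < n)%N -> Cpow (zeta (r * n)) n = zeta r.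
Proof.
move=> r0 n0; have rn0 : (0 < r * n)%N by rewrite muln_gt0 r0.
rewrite zeta_pow // -multE mult_INR /zeta.
have hr := INR_neq0 r0; have hn := INR_neq0 n0.
by replace (INR n * (2 * PI / (INR r * INR n))) with (2 * PI / INR r) by (field; split; assumption).
Qed.

Lemma V_cover r n z : V (r * n) z -> V r (Cpow z n).
Proof.
case=> z0 z1; split; first exact: Cpow_nz.
by rewrite -Cpow_mult_r multE mulnC.
Qed.

Lemma big_residue r n i (F : nat -> C) (ir : (i < r)%N) :
  \big[Cplus/RtoC 0]_(j < r * n | (j %% r == i)%N) F j =
  \big[Cplus/RtoC 0]_(k < n) F (i + k * r)%N.
Proof.
have r0 : (0 < r)%N by apply: leq_ltn_trans ir.
have lt (k : 'I_n) : (i + k * r < r * n)%N.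
  have := ltn_ord k; rewrite (mulnC r) -(leq_pmul2r r0) mulSn => H.
  by apply: leq_trans H; rewrite ltn_add2r.
  have lt' (j : 'I_(r * n)) : (j %/ r < n)%N by case: j => j /= H; rewrite ltn_divLR // mulnC.
rewrite (reindex_onto (fun k : 'I_n => Ordinal (lt k)) (fun j => Ordinal (lt' j))) /=.
  apply: eq_big => [k|k _ //].
  have e1 : ((i + k * r) %% r = i)%N by rewrite addnC modnMDl modn_small.
  have e2 : ((i + k * r) %/ r = k)%N by rewrite addnC divnMDl // divn_small // addn0.
  by rewrite -val_eqE /= e1 e2 !eqxx.
by move=> j /eqP E; apply: val_inj; rewrite /= -E addnC -divn_eq.
Qed.

(* Partial fractions: multiplying [1 / (z - a)] by [z^n - a^n] gives a geometric
   sum, whose terms of positive degree in [a] cancel over the [n]-th roots. *)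
Lemma sum_residue_inv r n i z : (0 < r)%N -> (0 < n)%N -> (i < r)%N -> V (r * n) z ->
  \big[Cplus/RtoC 0]_(j < r * n | (j %% r == i)%N) Cinv (z - Cpow (zeta (r * n)) j)%C =
  (RtoC (INR n) * Cpow z n.-1 * Cinv (Cpow z n - Cpow (zeta r) i))%C.
Proof.
move=> r0 n0 ir Vz; have rn0 : (0 < r * n)%N by rewrite muln_gt0 r0.
rewrite (big_residue n (fun j => Cinv (z - Cpow (zeta (r * n)) j)%C) ir).
set q := zeta (r * n).
have qn (k : nat) : Cpow (Cpow q (i + k * r)) n = Cpow (zeta r) i.
  rewrite -Cpow_mult_r PeanoNat.Nat.mul_comm Cpow_mult_r zeta_mul_pow //.
  rewrite -plusE Cpow_add_r -multE PeanoNat.Nat.mul_comm Cpow_mult_r zeta_pow_self //.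
  by rewrite Cpow_1_l Cmult_1_r.
have D0 : (Cpow z n - Cpow (zeta r) i)%C <> 0 by apply: V_minus_zeta; [|exact: V_cover].
have term (k : 'I_n) : Cinv (z - Cpow q (i + k * r)) =
    (\big[Cplus/RtoC 0]_(l < n) (Cpow z (n.-1 - l) * Cpow q i ^ l * Cpow (Cpow q (r * l)) k)
      * Cinv (Cpow z n - Cpow (zeta r) i))%C.
  have N0 : (z - Cpow q (i + k * r))%C <> 0 by apply: V_minus_zeta.
  have := Cpow_sub z (Cpow q (i + k * r)) n; rewrite qn => E.
  rewrite (eq_bigr (fun l : 'I_n => Cpow z (n.-1 - l) * Cpow (Cpow q (i + k * r)) l)%C).
    move: E; set s := \big[_/_]_(_ <- _ | _) _ => E; rewrite E in D0 *.
    have s0 : s <> 0 by move=> s0; apply: D0; rewrite s0 Cmult_0_r.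
    by field; split.
  move=> l _; rewrite -Cmult_assoc; congr Cmult.
  rewrite -plusE -!multE -!Cpow_mult_r -Cpow_add_r; congr Cpow.
  by rewrite !plusE !multE mulnDl; congr addn; rewrite mulnC mulnA.
rewrite (eq_bigr _ (fun k _ => term k)) -big_distrl exchange_big /=; congr Cmult.
rewrite (bigD1 (Ordinal n0)) //= [X in Cplus _ X]big1 ?Cplus_0_r.
  rewrite muln0 /= subn0 (eq_bigr (fun _ => Cpow z n.-1)) ?Csum_const // => k _.
  by rewrite Cpow_1_l; ring.
move=> l l0; rewrite -big_distrr /=.
(* This power is an n-th root of unity other than 1, so its powers sum to zero: 1 - w times the sum
   is 1 - w^n. *)
have w1 : Cpow q (r * l) <> 1.
  apply: zeta_pow_neq1; rewrite muln_gt0 r0 lt0n ltn_pmul2l // ltn_ord andbT.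
  by move: l0; rewrite -val_eqE.
set w := Cpow q (r * l) in w1 *.
have wn : Cpow w n = 1.
  rewrite /w -Cpow_mult_r multE mulnAC -multE Cpow_mult_r zeta_pow_self //.
  exact: Cpow_1_l.
have := Cpow_sub 1 w n; rewrite wn Cpow_1_l.
have -> : \big[Cplus/RtoC 0]_(l < n) (Cpow 1 (n.-1 - l) * Cpow w l)%C =
    \big[Cplus/RtoC 0]_(l < n) Cpow w l.
  by apply: eq_bigr => k _; rewrite Cpow_1_l Cmult_1_l.
set s := \big[_/_]_(_ <- _ | _) _ => E.
suff -> : s = 0 by rewrite Cmult_0_r.
have N0 : (1 - w)%C <> 0.
  by move=> E'; apply: w1; replace w with (1 - (1 - w))%C by ring; rewrite E'; ring.
replace s with ((1 - w) * s / (1 - w))%C by (field; exact: N0).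
by rewrite -E; field.
Qed.

(** The factor n z^(n-1) comes from d(z^n), and the exponent [x == letterX] puts the weight [n] on
    [X] only. At [X] this is d(z^n) / z^n = n dz / z; at a [Y] it is the partial fraction
    identity. *)
Lemma omega_cover r n z x : (0 < r)%N -> (0 < n)%N -> V (r * n) z ->
  (Cpow (RtoC (INR n)) (x == letterX) *
   \big[Cplus/RtoC 0]_(b : letter (r * n) | letter_mod b == x) omega (r * n) z [:: b])%C =
  (RtoC (INR n) * Cpow z n.-1 * omega r (Cpow z n) [:: x])%C.
Proof.
move=> r0 n0 Vz; case: x => [i|] /=.
  rewrite Cmult_1_l -sum_residue_inv //.
  rewrite (reindex_omap Some id) /=; last by case.
  by apply: eq_bigl => j; rewrite eqxx andbT.
rewrite (big_pred1 letterX) => [|b]; last exact: letter_mod_X.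
have z0 := proj1 Vz; case: n n0 Vz => // n _ Vz /=; rewrite Cmult_1_r.
field; split=> //; exact: Cpow_nz.
Qed.

Lemma is_velocity_cover n g t v : is_velocity g t v ->
  is_velocity (cover_path n.+1 g) t (RtoC (INR n.+1) * Cpow (g t) n * v)%C.
Proof.
move=> Hg; have [_ H] := has_deriv_pow n (has_deriv_id (g t)).
have := H g t v (erefl (g t)) Hg.
by congr is_velocity; ring.
Qed.

(** The equation for the image path concerns every time at which that path has a velocity, so [g]
    must be shown to have one there too. Dividing the difference of powers by its geometric factor,
    nonzero near [t], recovers a slope for [g]. *)
Lemma is_velocity_root n (g : R -> C) t v' : continuous g t -> g t <> 0 ->
  is_velocity (cover_path n.+1 g) t v' -> exists v, is_velocity g t v.
Proof.
move=> Cg g0 /is_velocityP[q [Hq qt Hc]].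
pose Q y := \big[Cplus/RtoC 0]_(l < n.+1) (Cpow y (n.+1.-1 - l) * Cpow (g t) l)%C.
have CQ : filterlim (fun s => Q (g s)) (locally t) (locally (Q (g t))).
  apply: filterlim_Csum => l; apply: filterlim_Cmult; last exact: filterlim_Cconst.
  exact: filterlim_Cpow.
have Q0 : Q (g t) <> 0.
  have -> : Q (g t) = (RtoC (INR n.+1) * Cpow (g t) n)%C.
    rewrite -Csum_const; apply: eq_bigr => [[i /= Hi] _].
    by rewrite -Cpow_add_r plusE subnK.
  by apply: Cmult_neq_0; [apply: RtoC_neq0; exact: INR_neq0 | exact: Cpow_nz].
exists (q t / Q (g t))%C.
apply: (@is_velocity_ext_loc (fun s => g t + RtoC (s - t) * (q s / Q (g s)))%C).
  have /filterlim_CP/(_ _ (proj1 (Cmod_gt_0 _) Q0)) := CQ.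
  apply: filter_imp => s Hs.
  have Qs : Q (g s) <> 0.
    by move=> E; move: Hs; rewrite E /Cminus Cplus_0_l Cmod_opp; lra.
  have := Cpow_sub (g s) (g t) n.+1; rewrite -/(Q (g s)).
  have := Hc s; rewrite /cover_path => -> E.
  replace (RtoC (s - t) * (q s / Q (g s)))%C with
    ((g t ^ n.+1 + RtoC (s - t) * q s - g t ^ n.+1) / Q (g s))%C by (field; exact: Qs).
  by rewrite E; field.
apply/is_velocityP; exists (fun s => q s / Q (g s))%C; split=> //.
  rewrite qt; apply: filterlim_Cmult => //; exact: filterlim_Cinv.
move=> s; congr Cplus.
replace (RtoC (t - t)) with (RtoC 0); first ring.
by congr RtoC; ring.
Qed.

Lemma push_nc1 r n (w : word r) : push (n := n) nc1 w = nc1 w.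
Proof.
rewrite -(ncexpX0 w) -[in RHS](Cmult_0_r (RtoC (INR n))) -push_expX.
by apply: eq_push => u; rewrite ncexpX0.
Qed.

Lemma solves_transport_cover r n (g : R -> C) a b (Phi : R -> ncseries (r * n)) : (0 < r)%N
  -> (0 < n)%N ->
  (forall t, a < t < b -> continuous g t) -> (forall t, a < t < b -> V (r * n) (g t)) ->
  solves_transport g a b Phi ->
  solves_transport (m := r) (cover_path n g) a b (fun t => push (r := r) (n := n) (Phi t)).
Proof.
move=> r0 n0 Cg Vg /solves_transport_flow[[HC HD] H0].
apply/solves_transport_flow; split; last first.
  by move=> w; rewrite (eq_push (T := nc1)) // push_nc1.
split=> [w|t v' tab Hv'].
  by move=> t tab; apply: filterlim_push => u; exact: HC.
have Vt := Vg t tab.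
have [v Hv] : exists v, is_velocity g t v.
  move: Hv'; case: n n0 Phi Vg HC HD H0 Vt => // n _ _ _ _ _ _ Vt.
  by apply: is_velocity_root; [exact: Cg | case: Vt].
have -> : v' = (RtoC (INR n) * Cpow (g t) n.-1 * v)%C.
  apply: is_velocity_unique Hv' _.
  case: n n0 {Vg HC HD H0 Vt} Phi => // n _ _; exact: is_velocity_cover.
have [D0 D1] := HD t v tab Hv; split=> [|w x].
  by have := is_velocity_scal (Cpow (RtoC (INR n)) 0) D0; rewrite Cmult_0_r.
have D (b0 : letter (r * n)) := is_velocity_sumlift w (fun u => D1 u b0).
have := is_velocity_scal (Cpow (RtoC (INR n)) (wtX (rcons w x)))
  (@is_velocity_sum _ (index_enum (letter (r * n))) (fun b0 => letter_mod b0 == x) _ _ t D).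
have -> : (RtoC (INR n) * Cpow (g t) n.-1 * v *
    (push (Phi t) w * omega r (cover_path n g t) [:: x]))%C =
  (v * push (Phi t) w * (RtoC (INR n) * Cpow (g t) n.-1 * omega r (Cpow (g t) n) [:: x]))%C.
  by rewrite /cover_path; ring.
rewrite -omega_cover //.
set A := (X in is_velocity _ t X -> _); set B := (X in _ -> is_velocity _ t X).
have -> : A = B.
  rewrite {}/A {}/B; move: (omega (r * n) (g t)) => om.
  rewrite big_distrr [in RHS]big_distrr [in RHS]big_distrr; apply: eq_bigr => b0 _ /=.
  (* The summand 0 gives the shape c * S + T required by [sumlift_linear]. *)
  rewrite (eq_sumlift (T := fun u => (v * om [:: b0] * Phi t u + 0)%C)); last first.
    by move=> u; rewrite Cplus_0_r (Cmult_comm (Phi t u)) Cmult_assoc.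
  rewrite (sumlift_linear _ (Phi t) (fun _ => RtoC 0)).
  have -> : sumlift (fun _ : word (r * n) => RtoC 0) w = 0.
    by elim: (w) => [|y u IH] //=; rewrite big1.
  rewrite /push /wtX -cats1 count_cat /= addn0 -plusE Cpow_add_r. set o := om _;
    set a1 := Cpow _ _; set a2 := Cpow _ _; set s1 := sumlift _ _; ring.
by apply: is_velocity_ext => s; rewrite /push sumlift_rcons.
Qed.

(** * Power series on a small disc *)

Definition is_Cseries (a : nat -> C) (l : C) : Prop :=
  is_series (K := R_AbsRing) (V := C_R_NormedModule) a l.

Lemma is_Cseries_unique a l l' : is_Cseries a l -> is_Cseries a l' -> l = l'.
Proof.
move=> H H'; exact: (@filterlim_locally_unique nat R_AbsRing C_R_NormedModule eventually
  (Proper_StrongProper _ eventually_filter) (sum_n a) l l' H H').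
Qed.

Lemma is_Cseries_ext a b l : (forall k, a k = b k) -> is_Cseries a l -> is_Cseries b l.
Proof. exact: is_series_ext. Qed.

Lemma is_Cseries_plus a b l l' : is_Cseries a l -> is_Cseries b l' ->
  is_Cseries (fun k => a k + b k)%C (l + l')%C.
Proof. exact: is_series_plus. Qed.

Lemma is_Cseries_scal c a l : is_Cseries a l -> is_Cseries (fun k => c * a k)%C (c * l)%C.
Proof.
move=> H; apply: (filterlim_ext (fun n => c * sum_n (G := C_R_NormedModule) a n)%C).
  elim=> [|n IH]; first by rewrite !sum_O.
  by rewrite !sum_Sn -IH; exact: Cmult_plus_distr_l.
by apply: filterlim_Cmult => //; exact: filterlim_Cconst.
Qed.

Arguments is_Cseries_scal c [a l] _ : rename.

Lemma ex_Cseries a M : (forall k, Cmod (a k) <= M * (1 / 2) ^ k) -> exists l, is_Cseries a l.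
Proof.
move=> H; apply: (ex_series_le (V := C_R_CompleteNormedModule) a (fun k => M * (1 / 2) ^ k)).
  by move=> k; rewrite norm_C_R.
apply: (ex_series_scal (V := R_NormedModule)); apply: ex_series_geom.
by split_Rabs; lra.
Qed.

Lemma Cseries_bound a l M : (forall k, Cmod (a k) <= M * (1 / 2) ^ k) ->
  is_Cseries a l -> Cmod l <= 2 * M.
Proof.
move=> H Hl; have M0 : 0 <= M by have := H 0%N; have := Cmod_ge_0 (a 0%N); rewrite /=; lra.
(* Keeping the closed form of the geometric sum, rather than its bound 2 M, makes the induction
   close. *)
have part n : Cmod (sum_n (G := C_R_NormedModule) a n) <= 2 * M - M * (1 / 2) ^ n.
  elim: n => [|n IH]; first by rewrite sum_O; have := H 0%N; rewrite /=; lra.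
  rewrite sum_Sn; apply: Rle_trans (Cmod_triangle _ _) _.
  by move: (H n.+1) IH; rewrite /=; lra.
apply: le_epsilon => eps eps0; have /filterlim_CP/(_ eps eps0)[n Hn] := Hl.
have {}Hn := Hn n (le_n n).
set s := sum_n _ n in Hn part.
replace l with (s - (s - l))%C by ring.
apply: Rle_trans (Cmod_triangle _ _) _; rewrite Cmod_opp.
have := part n; have : 0 <= M * (1 / 2) ^ n by apply: Rmult_le_pos => //; apply: pow_le; lra.
by rewrite -/s; lra.
Qed.

(** A quantitative form of radius of convergence at least 1/2. The ratio 2 makes the bound survive
    [coef_pole], where each new coefficient is built from two terms bounded by M 2^k. *)
Definition geom (c : nat -> C) : Prop := exists M, forall k, Cmod (c k) <= M * 2 ^ k.

Definition csum (c : nat -> C) (z : C) : C :=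
  Hierarchy.iota (T := C_R_CompleteNormedModule) (is_Cseries (fun k => c k * Cpow z k)%C).

Lemma csum_eq c z l : is_Cseries (fun k => c k * Cpow z k)%C l -> csum c z = l.
Proof. by move=> H; apply: iota_unique => // y Hy; exact: is_Cseries_unique Hy H. Qed.

Lemma pow_eighth_two k : (1 / 8) ^ k * 2 ^ k = (1 / 4) ^ k.
Proof. by rewrite -Rpow_mult_distr; congr pow; lra. Qed.

Lemma pow_quarter_two k : (1 / 4) ^ k * 2 ^ k = (1 / 2) ^ k.
Proof. by rewrite -Rpow_mult_distr; congr pow; lra. Qed.

Lemma pow_quarter_le k : 0 <= (1 / 4) ^ k <= (1 / 2) ^ k.
Proof. by split; [apply: pow_le | apply: pow_incr]; lra. Qed.

Lemma Cpow_disc z k : Cmod z < 1 / 8 -> Cmod (Cpow z k) <= (1 / 8) ^ k.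
Proof. by move=> zd; rewrite Cmod_pow; apply: pow_incr; have := Cmod_ge_0 z; lra. Qed.

Lemma geom_term c M z k : (forall k, Cmod (c k) <= M * 2 ^ k) -> Cmod z < 1 / 8 ->
  Cmod (c k * Cpow z k)%C <= M * (1 / 2) ^ k.
Proof.
move=> Hc zd; rewrite Cmod_mult.
have H := Rmult_le_compat _ _ _ _ (Cmod_ge_0 _) (Cmod_ge_0 _) (Hc k) (Cpow_disc k zd).
apply: Rle_trans H _; rewrite Rmult_assoc (Rmult_comm (2 ^ k)) pow_eighth_two.
apply: Rmult_le_compat_l; last by case: (pow_quarter_le k).
by have := Hc 0%N; have := Cmod_ge_0 (c 0%N); rewrite /=; lra.
Qed.

Lemma csum_series c z : geom c -> Cmod z < 1 / 8 ->
  is_Cseries (fun k => c k * Cpow z k)%C (csum c z).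
Proof.
case=> M Hc zd; have [l Hl] := ex_Cseries (fun k => geom_term k Hc zd).
by rewrite (csum_eq Hl).
Qed.

Lemma csum_small c : geom c -> c 0%N = 0 ->
  exists K, 0 <= K /\ forall z, Cmod z < 1 / 8 -> Cmod (csum c z) <= K * Cmod z.
Proof.
case=> M Hc c0; have M0 : 0 <= M by have := Hc 0%N; have := Cmod_ge_0 (c 0%N); rewrite /=; lra.
exists (16 * M); split=> [|z zd]; first lra.
have := @Cseries_bound (fun k => c k * Cpow z k)%C (csum c z) (8 * M * Cmod z).
rewrite (_ : 2 * (8 * M * Cmod z) = 16 * M * Cmod z); last ring.
apply; last by apply: csum_series => //; exists M.
case=> [|k].
  rewrite c0 Cmult_0_l Cmod_0 /=; have := Cmod_ge_0 z; nra.
rewrite Cpow_S !Cmod_mult.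
have H := Rmult_le_compat _ _ _ _ (Cmod_ge_0 _) (Cmod_ge_0 _) (Hc k.+1) (Cpow_disc k zd).
have [q0 q1] := pow_quarter_le k; have z0 := Cmod_ge_0 z.
have E : M * 2 ^ k.+1 * (1 / 8) ^ k = 2 * M * (1 / 4) ^ k.
  by rewrite -pow_eighth_two /=; ring.
rewrite E in H; rewrite (_ : 8 * M * Cmod z * (1 / 2) ^ k.+1 = Cmod z * (4 * M * (1 / 2) ^
  k)); last by rewrite /=; field.
rewrite -Rmult_assoc (Rmult_comm (Cmod (c _))) Rmult_assoc.
apply: Rmult_le_compat_l => //; apply: Rle_trans H _.
by have := Rmult_le_compat_l _ _ _ M0 q1; nra.
Qed.

Lemma INR_le_pow2 k : INR k <= 2 ^ k.
Proof.
elim: k => [|k IH]; first by rewrite /=; lra.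
rewrite S_INR /=; have : 1 <= 2 ^ k by apply: pow_R1_Rle; lra.
lra.
Qed.

(** The remainders satisfy e_(k+1) = y e_k + k (y - z)^2 z^(k-1). The last term is at most 8 (1/4)^k
    |y - z|^2, and 64 is the constant for which 64/8 + 8 = 64/4. *)
Lemma Cpow_second_order y z k : Cmod y < 1 / 8 -> Cmod z < 1 / 8 ->
  Cmod (Cpow y k - Cpow z k - RtoC (INR k) * (y - z) * Cpow z k.-1)%C <=
  64 * Cmod (y - z)%C ^ 2 * (1 / 4) ^ k.
Proof.
move=> yd zd; set D := Cmod (y - z)%C ^ 2.
have D0 : 0 <= D by apply: pow_le; exact: Cmod_ge_0.
elim: k => [|k IH].
  replace (_ - _ - _)%C with (RtoC 0) by (rewrite /=; ring).
  by rewrite Cmod_0 /=; lra.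
have E : (y ^ k.+1 - z ^ k.+1 - INR k.+1 * (y - z) * z ^ k.+1.-1 =
   y * (y ^ k - z ^ k - INR k * (y - z) * z ^ k.-1) +
   (y - z) * (y - z) * (INR k * z ^ k.-1))%C.
  rewrite S_INR RtoC_plus; case: k {IH} => [|k] /=; ring.
rewrite E; apply: Rle_trans (Cmod_triangle _ _) _; rewrite !Cmod_mult.
have -> : Cmod (y - z)%C * Cmod (y - z)%C = D by rewrite /D /=; ring.
have H1 := Rmult_le_compat _ _ _ _ (Cmod_ge_0 _) (Cmod_ge_0 _) (Rlt_le _ _ yd) IH.
have H2 : Cmod (RtoC (INR k)) * Cmod (Cpow z k.-1) <= 8 * (1 / 4) ^ k.
  rewrite Cmod_R Rabs_pos_eq; last exact: pos_INR.
  case: k {IH E H1} => [|k]; first by rewrite Rmult_0_l /=; lra.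
  have := Rmult_le_compat _ _ _ _ (pos_INR _) (Cmod_ge_0 _) (INR_le_pow2 k.+1) (Cpow_disc k zd).
  have := pow_eighth_two k; have := pow_quarter_le k; rewrite -/(k.+1.-1) /=; nra.
have H3 := Rmult_le_compat_l _ _ _ D0 H2.
move: H1 H3; rewrite /=; lra.
Qed.

(** Coefficients of the primitive of [csum s z / z]. At k = 0 the division by zero is harmless,
    since the constant term of [s] is 0 in every use. *)
Definition coef_prim (s : nat -> C) (k : nat) : C := (s k / RtoC (INR k))%C.

Lemma coef_primK (s : nat -> C) k : s 0%N = 0 -> (coef_prim s k * RtoC (INR k))%C = s k.
Proof.
move=> s0; rewrite /coef_prim; case: k => [|k]; first by rewrite s0 /Cdiv Cmult_0_l Cmult_0_l.
by field; apply: RtoC_neq0; exact: INR_neq0.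
Qed.

Lemma coef_prim_le (s : nat -> C) k : s 0%N = 0 -> Cmod (coef_prim s k) <= Cmod (s k).
Proof.
move=> s0; rewrite /coef_prim; case: k => [|k].
  by rewrite s0 /Cdiv Cmult_0_l; exact: Rle_refl.
have n0 : INR k.+1 <> 0 by exact: INR_neq0.
rewrite Cmod_div; last exact: RtoC_neq0.
rewrite Cmod_R Rabs_pos_eq; last exact: pos_INR.
have n1 : 1 <= INR k.+1 by rewrite S_INR; have := pos_INR k; lra.
apply: (Rmult_le_reg_r (INR k.+1)); first lra.
rewrite /Rdiv Rmult_assoc Rinv_l // Rmult_1_r.
have := Cmod_ge_0 (s k.+1); nra.
Qed.

Lemma geom_prim s : geom s -> s 0%N = 0 -> geom (coef_prim s).
Proof.
by case=> M H s0; exists M => k; apply: Rle_trans (coef_prim_le k s0) (H k).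
Qed.

(** Termwise Taylor expansion: by [Cpow_second_order] the k-th remainder is at most 64 M (1/2)^k |y
    - z|^2, and summing this geometric series gives the constant 128 M. *)
Lemma has_deriv_csum s z : geom s -> s 0%N = 0 -> Cmod z < 1 / 8 -> z <> 0 ->
  has_deriv (csum (coef_prim s)) z (csum s z / z)%C.
Proof.
move=> gs s0 zd z0; have [M HM] := gs; have gt := geom_prim gs s0.
have M0 : 0 <= M by have := HM 0%N; have := Cmod_ge_0 (s 0%N); rewrite /=; lra.
have rho0 : 0 < 1 / 8 - Cmod z by lra.
apply: (@has_deriv_quadratic _ _ _ (128 * M) _ rho0) => y yz.
have yd : Cmod y < 1 / 8.
  replace y with (y - z + z)%C by ring.
  by apply: Rle_lt_trans (Cmod_triangle _ _) _; lra.
have Sy := csum_series gt yd; have Sz := csum_series gt zd; have Ss := csum_series gs zd.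
have := is_Cseries_plus (is_Cseries_plus Sy (is_Cseries_scal (RtoC (-1)) Sz))
  (is_Cseries_scal (Cmult (RtoC (-1)) ((y - z) / z)%C) Ss).
set l := (X in is_Cseries _ X).
have -> : (csum (coef_prim s) y - csum (coef_prim s) z - (y - z) * (csum s z / z))%C = l.
  by rewrite /l; field.
move=> Hl; rewrite (_ : 128 * M * _ = 2 * (64 * M * Cmod (y - z)%C ^ 2)); last ring.
apply: Cseries_bound Hl => k.
have -> : (coef_prim s k * y ^ k + RtoC (-1) * (coef_prim s k * z ^ k) +
    RtoC (-1) * ((y - z) / z) * (s k * z ^ k))%C =
    (coef_prim s k * (y ^ k - z ^ k - RtoC (INR k) * (y - z) * z ^ k.-1))%C.
  rewrite -(coef_primK k s0); case: k => [|k] /=; field; exact: z0.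
rewrite Cmod_mult.
have := Rmult_le_compat _ _ _ _ (Cmod_ge_0 _) (Cmod_ge_0 _)
  (Rle_trans _ _ _ (coef_prim_le k s0) (HM k)) (Cpow_second_order k yd zd).
by rewrite -pow_quarter_two; lra.
Qed.

(* The coefficients of [z / (z - a)] times the series with coefficients [c]. *)
Fixpoint coef_pole (a : C) (c : nat -> C) (k : nat) : C :=
  if k is k'.+1 then ((coef_pole a c k' - c k') / a)%C else 0.

Lemma geom_pole a c : Cmod a = 1 -> geom c -> geom (coef_pole a c).
Proof.
move=> a1 [M H]; exists M.
have M0 : 0 <= M by have := H 0%N; have := Cmod_ge_0 (c 0%N); rewrite /=; lra.
have a0 : a <> 0 by apply/Cmod_gt_0; lra.
elim=> [|k IH]; first by rewrite /= Cmod_0; lra.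
rewrite [coef_pole _ _ _]/= Cmod_div // a1 /Rdiv Rinv_1 Rmult_1_r.
apply: Rle_trans (Cmod_triangle _ _) _; rewrite Cmod_opp.
by have := H k; rewrite /=; lra.
Qed.

(** In terms of coefficients, a b_(k+1) = b_k - c_k says that (z - a) B = z S, where B and S are the
    two sums. *)
Lemma csum_pole a c z : Cmod a = 1 -> geom c -> Cmod z < 1 / 8 ->
  csum (coef_pole a c) z = (z / (z - a) * csum c z)%C.
Proof.
move=> a1 gc zd; have a0 : a <> 0 by apply/Cmod_gt_0; lra.
have za : (z - a)%C <> 0.
  move=> E; have : z = a by replace z with (z - a + a)%C by ring; rewrite E Cplus_0_l.
  by move=> E'; rewrite E' a1 in zd; lra.
have Sb := csum_series (geom_pole a1 gc) zd; have Sc := csum_series gc zd.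
set B := csum (coef_pole a c) z in Sb *; set S := csum c z in Sc *.
have Sb1 : is_Cseries (fun k => coef_pole a c k.+1 * Cpow z k.+1)%C B.
  apply: (is_series_incr_1 (V := C_R_NormedModule) (fun k => coef_pole a c k * Cpow z k)%C).
  suff -> : plus (B : C_R_NormedModule) (coef_pole a c 0 * Cpow z 0)%C = B by [].
  by rewrite /= Cmult_0_l; exact: Cplus_0_r.
have H1 := is_Cseries_scal a Sb1.
have H2 := is_Cseries_plus (is_Cseries_scal z Sb) (is_Cseries_scal (Cmult (RtoC (-1)) z) Sc).
have E : (a * B = z * B + RtoC (-1) * z * S)%C.
  apply: is_Cseries_unique H1 _; apply: is_Cseries_ext H2 => k.
  by rewrite /=; field.
replace B with (((z * B) - (a * B)) / (z - a))%C by (field; exact: za).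
by rewrite E; field.
Qed.

Lemma geom_scal a c : geom c -> geom (fun k => a * c k)%C.
Proof.
case=> M H; exists (Cmod a * M) => k; rewrite Cmod_mult Rmult_assoc.
by apply: Rmult_le_compat_l => //; exact: Cmod_ge_0.
Qed.

Lemma csum_scal a c z : geom c -> Cmod z < 1 / 8 ->
  csum (fun k => a * c k)%C z = (a * csum c z)%C.
Proof.
move=> gc zd; apply: csum_eq; apply: is_Cseries_ext (is_Cseries_scal a (csum_series gc zd)).
by move=> k; rewrite Cmult_assoc.
Qed.

Definition coef1 (k : nat) : C := if k is 0%N then RtoC 1 else RtoC 0.

Lemma geom_coef1 : geom coef1.
Proof.
exists 1 => -[|k]; rewrite /= ?Cmod_1 ?Cmod_0; first lra.
have : 0 <= 2 ^ k by apply: pow_le; lra.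
lra.
Qed.

Lemma csum_coef1 z : csum coef1 z = 1.
Proof.
apply: csum_eq; apply: (filterlim_ext (fun _ => RtoC 1)); last exact: filterlim_Cconst.
elim=> [|n IH]; first by rewrite sum_O /= Cmult_1_r.
by rewrite sum_Sn -IH /= Cmult_0_l; symmetry; exact: Cplus_0_r.
Qed.

(** * Polylogarithmic functions near the tangential base point *)

(** A half-disc on which [clog] is a branch of the logarithm; its radius is that of the estimates on
    [csum]. A tangential path lies in it for small positive times. *)
Definition sector (z : C) : Prop := 0 < z.1 /\ Cmod z < 1 / 8.

Lemma sector_neq0 z : sector z -> z <> 0.
Proof. by case=> z1 _ E; rewrite E /= in z1; lra. Qed.

Definition clog (z : C) : C := (ln (Cmod z), atan (z.2 / z.1)).

Lemma has_deriv_clog (z : C) : 0 < z.1 -> has_deriv clog z (/ z)%C.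
Proof.
move=> z1; split.
  have n0 : z.1 ^ 2 + z.2 ^ 2 <> 0 by nra.
  have C1 : filterlim (fun w : C => w.1) (locally z) (locally z.1).
    by apply: filterlim_Cfst; exact: filterlim_id.
  have C2 : filterlim (fun w : C => w.2) (locally z) (locally z.2).
    by apply: filterlim_Csnd; exact: filterlim_id.
  apply: filterlim_Cpair.
    apply: (filterlim_comp _ _ _ Cmod ln _ (locally (Cmod z))).
      exact: (filterlim_norm (V := C_NormedModule) z).
    apply: continuous_ln; apply: (Rlt_le_trans _ (Rabs z.1)).
      by apply: Rabs_pos_lt; lra.
    exact: Cmod_fst_le.
  apply: (filterlim_comp _ _ _ (fun w : C => w.2 / w.1) atan _ (locally (z.2 / z.1))).
    have z10 : z.1 <> 0 by lra.
    exact: (filterlim_Rmult C2 (filterlim_Rinv z10 C1)).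
  exact: continuous_atan.
move=> g t v gt Hg.
pose x (s : R) : R := (g s).1; pose y (s : R) : R := (g s).2.
have H1 : is_derive x t v.1 := is_velocity_fst Hg.
have H2 : is_derive y t v.2 := is_velocity_snd Hg.
have p0 : 0 < x t by rewrite /x gt.
have n0 : 0 < x t ^ 2 + y t ^ 2 by nra.
have [E1 E2] : z.1 = x t /\ z.2 = y t by rewrite /x /y gt.
have d1 : ex_derive x t by exists v.1.
have d2 : ex_derive y t by exists v.2.
apply: is_velocity_pair.
- apply: (is_derive_ext (fun s => / 2 * ln (x s ^ 2 + y s ^ 2))) => [s|].
    change (/ 2 * ln (x s ^ 2 + y s ^ 2) = ln (sqrt (x s ^ 2 + y s ^ 2))).
    (* The path may reach 0 at other times; there the two sides agree by the convention ln 0 = 0. *)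
    case: (Rle_lt_dec (x s ^ 2 + y s ^ 2) 0) => le.
      have -> : x s ^ 2 + y s ^ 2 = 0 by nra.
      by rewrite sqrt_0 /ln; case: (Rlt_dec 0 0) => h; [exfalso; lra | lra].
    have sp := sqrt_lt_R0 _ le.
    by rewrite -{1}(sqrt_sqrt _ (Rlt_le _ _ le)) (ln_mult _ _ sp sp); field.
  have -> : (v * / z)%C.1 = / 2 * (/ (x t ^ 2 + y t ^ 2) * (2 * x t * v.1 + 2 * y t * v.2)).
    by rewrite /= E1 E2; field; rewrite /= in n0; lra.
  auto_derive.
    by do !split.
  by rewrite (is_derive_unique _ _ _ H1) (is_derive_unique _ _ _ H2); field; rewrite /= in n0; lra.
- apply: (is_derive_ext (fun s => atan (y s / x s))) => //.
  have -> : (v * / z)%C.2 = / (1 + (y t / x t) ^ 2) * ((v.2 * x t - y t * v.1) / x t ^ 2).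
    by rewrite /= E1 E2; field; split; [lra | nra].
  auto_derive.
    by do !split => //; lra.
  rewrite (is_derive_unique _ _ _ H1) (is_derive_unique _ _ _ H2); field.
  by split; [nra | lra].
Qed.

(** Finite sums of terms (log z)^j S(z) with S(0) = 0, known only on the sector. The inductive form
    yields closure properties without handling lists of terms. *)
Inductive small : (C -> C) -> Prop :=
| small_term j c : geom c -> c 0%N = 0 -> small (fun z => Cpow (clog z) j * csum c z)%C
| small_plus f g : small f -> small g -> small (fun z => f z + g z)%C
| small_ext f g : (forall z, sector z -> f z = g z) -> small f -> small g.

Lemma small_scal a f : small f -> small (fun z => a * f z)%C.
Proof.
elim=> [j c gc c0|h k _ IHh _ IHk|h k E _ IH].
- apply: small_ext (small_term j (geom_scal a gc) _) => [z [_ zd]|].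
    by rewrite csum_scal //; ring.
  by rewrite c0 Cmult_0_r.
- by apply: small_ext (small_plus IHh IHk) => z _; ring.
- by apply: small_ext IH => z /E ->.
Qed.

Lemma small_clog f : small f -> small (fun z => clog z * f z)%C.
Proof.
elim=> [j c gc c0|h k _ IHh _ IHk|h k E _ IH].
- by apply: small_ext (small_term j.+1 gc c0) => z _; rewrite Cpow_S; ring.
- by apply: small_ext (small_plus IHh IHk) => z _; ring.
- by apply: small_ext IH => z /E ->.
Qed.

Lemma small_clog_pow j f : small f -> small (fun z => Cpow (clog z) j * f z)%C.
Proof.
move=> Hf; elim: j => [|j IH]; first by apply: small_ext Hf => z _; rewrite /= Cmult_1_l.
by apply: small_ext (small_clog IH) => z _; rewrite Cpow_S Cmult_assoc.
Qed.

Lemma small_pole a f : Cmod a = 1 -> small f -> small (fun z => z / (z - a) * f z)%C.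
Proof.
move=> a1; elim=> [j c gc c0|h k _ IHh _ IHk|h k E _ IH].
- apply: small_ext (small_term j (geom_pole a1 gc) (erefl _)) => z [_ zd].
  by rewrite csum_pole //; ring.
- by apply: small_ext (small_plus IHh IHk) => z _; ring.
- by apply: small_ext IH => z /E ->.
Qed.

Lemma small_pole1 a : Cmod a = 1 -> small (fun z => z / (z - a))%C.
Proof.
move=> a1; apply: small_ext (small_term 0 (geom_pole a1 geom_coef1) (erefl _)) => z [_ zd].
by rewrite csum_pole ?csum_coef1 //=; [ring | exact: geom_coef1].
Qed.

Lemma small0 : small (fun _ => 0).
Proof.
apply: small_ext (small_scal 0 (small_pole1 Cmod_1)) => z _; exact: Cmult_0_l.
Qed.

Lemma small_sum (I : Type) (r : seq I) (P : pred I) (f : I -> C -> C) :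
  (forall i, small (f i)) -> small (fun z => \big[Cplus/RtoC 0]_(i <- r | P i) f i z).
Proof.
move=> H; elim: r => [|i r IH].
  by apply: small_ext small0 => z _; rewrite big_nil.
apply: (@small_ext (fun z => if P i then (f i z + \big[Cplus/RtoC 0]_(j <- r | P j) f j z)%C
  else \big[Cplus/RtoC 0]_(j <- r | P j) f j z)) => [z _|].
  by rewrite big_cons.
by case: (P i) => //; exact: small_plus.
Qed.

(** Integration by parts: if T' = S / z, a primitive of (log z)^(j+1) S / z is (log z)^(j+1) T minus
    j + 1 times a primitive of (log z)^j T / z. As S(0) = 0, the series T can again be taken to
    vanish at 0, and the induction on j stays in the class. *)
Lemma small_prim f : small f ->
  exists F, small F /\ forall z, sector z -> has_deriv F z (f z / z)%C.
Proof.
elim=> [j c gc c0|h k _ [H [sH dH]] _ [K [sK dK]]|h k E _ [H [sH dH]]].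
- elim: j c gc c0 => [|j IH] c gc c0.
    have gp := geom_prim gc c0.
    have p0 : coef_prim c 0 = 0 by rewrite /coef_prim c0 /Cdiv Cmult_0_l.
    exists (fun z => Cpow (clog z) 0 * csum (coef_prim c) z)%C; split; first exact: small_term.
    move=> z Dz; have := has_deriv_scal 1 (has_deriv_csum gc c0 (proj2 Dz) (sector_neq0 Dz)).
    by rewrite /= !Cmult_1_l.
  have gp := geom_prim gc c0.
  have p0 : coef_prim c 0 = 0 by rewrite /coef_prim c0 /Cdiv Cmult_0_l.
  have [G [sG dG]] := IH _ gp p0.
  exists (fun z => Cpow (clog z) j.+1 * csum (coef_prim c) z + - RtoC (INR j.+1) * G z)%C.
  split; first by apply: small_plus; [exact: small_term | exact: small_scal].
  move=> z Dz; have z0 := sector_neq0 Dz.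
  have := has_deriv_plus
    (has_deriv_mult (has_deriv_pow j (has_deriv_clog (proj1 Dz)))
      (has_deriv_csum gc c0 (proj2 Dz) z0)) (has_deriv_scal (- RtoC (INR j.+1))%C (dG z Dz)).
  set d := (X in has_deriv _ _ X); set d' := (X in _ -> has_deriv _ _ X).
  suff -> : d = d' by [].
  by rewrite /d /d'; field.
- exists (fun z => H z + K z)%C; split; first exact: small_plus.
  move=> z Dz; have := has_deriv_plus (dH z Dz) (dK z Dz).
  by rewrite /Cdiv -Cmult_plus_distr_r.
- by exists H; split=> // z Dz; rewrite -E //; exact: dH.
Qed.

(** The inequality u <= exp u at u = y / (j + 1), raised to the power j + 1. *)
Lemma pow_le_exp j y : 0 <= y -> y ^ j.+1 <= INR j.+1 ^ j.+1 * exp y.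
Proof.
move=> y0; have j0 : 0 < INR j.+1 by apply: lt_0_INR; apply/ltP.
have -> : exp y = exp (y / INR j.+1) ^ j.+1.
  have expn u k : exp u ^ k = exp (INR k * u).
    elim: k => [|k IH]; first by rewrite /= Rmult_0_l exp_0.
    by rewrite -tech_pow_Rmult IH -exp_plus S_INR; congr exp; ring.
  by rewrite expn; congr exp; field; lra.
rewrite -Rpow_mult_distr; apply: pow_incr; split=> //.
have := exp_ineq1_le (y / INR j.+1) => H.
have : INR j.+1 * (y / INR j.+1) <= INR j.+1 * exp (y / INR j.+1).
  by apply: Rmult_le_compat_l; lra.
by replace (INR j.+1 * (y / INR j.+1)) with y by (field; lra).
Qed.

Lemma Cmod_clog_le z : Cmod z < 1 -> z <> 0 -> Cmod (clog z) <= 2 - ln (Cmod z).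
Proof.
move=> z1 /Cmod_gt_0 z0; have l0 : ln (Cmod z) < 0 by rewrite -ln_1; apply: ln_increasing.
have -> : clog z = (RtoC (ln (Cmod z)) + Ci * RtoC (atan (z.2 / z.1)))%C.
  by apply: injective_projections => /=; ring.
apply: Rle_trans (Cmod_triangle _ _) _; rewrite Cmod_mult Cmod_Ci !Cmod_R.
(* The constant 2 bounds |atan| < pi / 2, as pi <= 4. *)
have := atan_bound (z.2 / z.1); have := PI_4 => ? ?.
by split_Rabs; lra.
Qed.

(** With y = 2 - ln |z| one has |z| = exp 2 / exp y, hence y^(j+1) |z| <= K; the choice of the
    radius gives y > K / eps, and dividing by y leaves y^j |z| < eps. *)
Lemma clog_pow_small j eps : 0 < eps -> exists d, 0 < d /\
  forall z, sector z -> Cmod z < d -> Cmod (clog z) ^ j * Cmod z < eps.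
Proof.
move=> eps0; pose K := exp 2 * INR j.+1 ^ j.+1.
have K0 : 0 < K.
  apply: Rmult_lt_0_compat; first exact: exp_pos.
  by apply: pow_lt; apply: lt_0_INR; apply/ltP.
exists (exp (- (K / eps))); split=> [|z Dz zd]; first exact: exp_pos.
have z0 := sector_neq0 Dz; have m0 := proj1 (Cmod_gt_0 _) z0; have zs := proj2 Dz.
have l0 : ln (Cmod z) < 0 by rewrite -ln_1; apply: ln_increasing; lra.
have l1 : K / eps < - ln (Cmod z).
  by have := ln_increasing _ _ m0 zd; rewrite ln_exp; lra.
pose y := 2 - ln (Cmod z); have y0 : 0 < y by rewrite /y; lra.
have Ly : Cmod (clog z) <= y by apply: Cmod_clog_le => //; lra.
have Ez : Cmod z = exp 2 * / exp y.
  by rewrite -exp_Ropp -exp_plus /y -{1}(exp_ln _ m0); congr exp; ring.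
have P1 : Cmod (clog z) ^ j <= y ^ j by apply: pow_incr; split=> //; exact: Cmod_ge_0.
have P2 := pow_le_exp j (Rlt_le _ _ y0).
apply: (Rle_lt_trans _ (y ^ j * Cmod z)); first by apply: Rmult_le_compat_r => //; lra.
apply: (Rmult_lt_reg_l y) => //.
have e0 := exp_pos y; have e2 := exp_pos 2.
apply: (Rle_lt_trans _ K).
  rewrite Ez -Rmult_assoc.
  have -> : y * y ^ j * (exp 2 * / exp y) = exp 2 * (y ^ j.+1 * / exp y) by rewrite /=; ring.
  apply: Rmult_le_compat_l; first lra.
  apply: (Rmult_le_reg_r (exp y)) => //; rewrite Rmult_assoc Rinv_l; lra.
have := Rmult_lt_compat_r _ _ _ eps0 (Rlt_trans _ _ y l1 _).
rewrite /Rdiv Rmult_assoc Rinv_l; last lra.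
rewrite Rmult_1_r; apply; rewrite /y; lra.
Qed.

Lemma small_lim f : small f -> forall eps, 0 < eps -> exists d, 0 < d /\
  forall z, sector z -> Cmod z < d -> Cmod (f z) < eps.
Proof.
elim=> [j c gc c0|h k _ IHh _ IHk|h k E _ IH] eps eps0.
- have [K [K0 HK]] := csum_small gc c0.
  have e0 : 0 < eps / (K + 1) by apply: Rdiv_lt_0_compat; lra.
  have [d [d0 Hd]] := clog_pow_small j e0; exists d; split=> // z Dz zd.
  rewrite Cmod_mult Cmod_pow; have H := Hd z Dz zd.
  have L0 : 0 <= Cmod (clog z) ^ j by apply: pow_le; exact: Cmod_ge_0.
  have z0 := Cmod_ge_0 z.
  apply: (Rle_lt_trans _ ((K + 1) * (Cmod (clog z) ^ j * Cmod z))).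
    have := Rmult_le_compat_l _ _ _ L0 (HK z (proj2 Dz)).
    by have := Rmult_le_pos _ _ L0 z0; nra.
  have := Rmult_lt_compat_l (K + 1) _ _ _ H.
  by replace ((K + 1) * (eps / (K + 1))) with eps by (field; lra); apply; lra.
- have e0 : 0 < eps / 2 by lra.
  have [d [d0 Hd]] := IHh _ e0; have [d' [d'0 Hd']] := IHk _ e0.
  exists (Rmin d d'); split; first exact: Rmin_pos.
  move=> z Dz zd; apply: Rle_lt_trans (Cmod_triangle _ _) _.
  have := Hd z Dz (Rlt_le_trans _ _ _ zd (Rmin_l _ _)).
  by have := Hd' z Dz (Rlt_le_trans _ _ _ zd (Rmin_r _ _)); lra.
- have [d [d0 Hd]] := IH eps eps0; exists d; split=> // z Dz zd.
  by rewrite -E //; exact: Hd.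
Qed.

(** Choosing a primitive by a total operator lets [remainder_rev] be defined by recursion before its
    integrands are known to be small. *)
Definition prim (f : C -> C) : C -> C :=
  epsilon (inhabits f) (fun F => small F /\ forall z, sector z -> has_deriv F z (f z / z)%C).

Lemma primP f : small f ->
  small (prim f) /\ forall z, sector z -> has_deriv (prim f) z (f z / z)%C.
Proof. by move=> sf; have H := small_prim sf; rewrite /prim;
  exact: (epsilon_spec (inhabits f) _ H). Qed.

(** * The local solution [exp(log z X) + remainder] *)

Lemma has_deriv_divpow (z : C) k : 0 < z.1 ->
  has_deriv (fun y => divpow (clog y) k.+1) z (divpow (clog z) k / z)%C.
Proof.
move=> z1; have z0 : z <> 0 by move=> E; rewrite E /= in z1; lra.
have := has_deriv_scal (/ RtoC (INR k.+1`!))%C (has_deriv_pow k (has_deriv_clog z1)).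
have -> : (/ RtoC (INR k.+1`!) * (RtoC (INR k.+1) * clog z ^ k * / z) =
    divpow (clog z) k / z)%C.
  rewrite /divpow factS -multE mult_INR RtoC_mult.
  have h1 := RtoC_neq0 (INR_neq0 (fact_gt0 k)); have h2 := RtoC_neq0 (INR_neq0 (ltn0Sn k)).
  by field.
by apply: has_deriv_ext => s; rewrite /divpow /Cdiv Cmult_comm.
Qed.

Section LocalSolution.

Variable m : nat.
Hypothesis m0 : (0 < m)%N.

(** The factor z / (z - a) offsets the 1 / z built into [prim]. For a final [X] the exponential is
    absent from the integrand because its coefficient already integrates to the next divided
    power. *)
Fixpoint remainder_rev (u : word m) : C -> C :=
  match u with
  | [::] => fun _ => RtoC 0
  | None :: u' => prim (remainder_rev u')
  | Some i :: u' => prim (fun z => z / (z - Cpow (zeta m) i) *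
      (ncexpX (clog z) (rev u') + remainder_rev u' z))%C
  end.

Definition remainder (z : C) : ncseries m := fun w => remainder_rev (rev w) z.

Definition local_solution (z : C) : ncseries m :=
  fun w => (ncexpX (clog z) w + remainder z w)%C.

Lemma small_pole_ncexpX a (w : word m) : Cmod a = 1 ->
  small (fun z => z / (z - a) * ncexpX (clog z) w)%C.
Proof.
move=> a1; case Hw: (all (pred1 letterX) w); last first.
  by apply: small_ext small0 => z _; rewrite ncexpXE Hw Cmult_0_r.
apply: small_ext (small_scal (/ RtoC (INR (size w)`!)) (small_clog_pow (size w) (small_pole1
  a1))) => z _.
by rewrite ncexpXE Hw /divpow /Cdiv; ring.
Qed.

Lemma small_integrand i (w : word m) (R : C -> C) : small R ->
  small (fun z => z / (z - Cpow (zeta m) i) * (ncexpX (clog z) w + R z))%C.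
Proof.
have a1 := Cmod_zeta_pow i m0 => sR.
by apply: small_ext (small_plus (small_pole_ncexpX w a1) (small_pole a1 sR)) => z _; ring.
Qed.

Lemma small_remainder w : small (fun z => remainder z w).
Proof.
rewrite /remainder; elim: (rev w) => [|[i|] u IH] /=; first exact: small0.
- by case: (primP (small_integrand i (rev u) IH)).
- by case: (primP IH).
Qed.

Lemma remainder_nil z : remainder z [::] = 0.
Proof. by []. Qed.

Lemma local_solution_nil z : local_solution z [::] = 1.
Proof. by rewrite /local_solution /remainder /= Cplus_0_r ncexpXE /= /divpow /=; field;
  case; lra. Qed.

Lemma has_deriv_local_solution w x z : sector z ->
  has_deriv (fun y => local_solution y (rcons w x)) z
    (local_solution z w * omega m z [:: x])%C.
Proof.
move=> Dz; have z0 := sector_neq0 Dz; have sR := small_remainder w.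
rewrite /local_solution /remainder rev_rcons; case: x => [i|].
- have [_ /(_ z Dz)] := primP (small_integrand i w sR).
  have a1 := Cmod_zeta_pow i m0.
  have za : (z - Cpow (zeta m) i)%C <> 0.
    move=> E; have : z = Cpow (zeta m) i.
      by replace z with (z - Cpow (zeta m) i + Cpow (zeta m) i)%C by ring; rewrite E Cplus_0_l.
    by move=> E'; case: Dz => _; rewrite E' a1; lra.
  set F := prim _ => H; move: H; set d := (X in has_deriv _ _ X) => H.
  have -> : ((ncexpX (clog z) w + remainder_rev (rev w) z) * omega m z [:: Some i] = 0 + d)%C.
    by rewrite /d /remainder /=; field.
  have := has_deriv_plus (@has_deriv_const 0 z) H.
  apply: has_deriv_ext => s.
  by rewrite ncexpXE all_rcons /= /F revK.
- have [_ /(_ z Dz) H] := primP sR.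
  (* If [w] is a power of [X], the exponential part differentiates to the previous divided power;
     otherwise its coefficients at [w] and at [w] followed by [X] are both 0. *)
  case Hw: (all (pred1 letterX) w).
    have := has_deriv_plus (has_deriv_divpow (size w) (proj1 Dz)) H.
    rewrite /= ncexpXE Hw /Cdiv -Cmult_plus_distr_r.
    apply: has_deriv_ext => s.
    by rewrite ncexpXE all_rcons Hw /= size_rcons.
  have := has_deriv_plus (@has_deriv_const 0 z) H.
  rewrite /= ncexpXE Hw Cplus_0_l Cplus_0_l.
  apply: has_deriv_ext => s.
  by rewrite ncexpXE all_rcons Hw.
Qed.

End LocalSolution.

(** * Convergence of the regularized transport *)

Lemma is_flow_sub m g a b a' b' (Phi : R -> ncseries m) : a <= a' -> b' <= b ->
  is_flow g a b Phi -> is_flow g a' b' Phi.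
Proof.
move=> aa' bb' [HC HD]; split.
  by move=> w; apply: continuous_on_subset (HC w) => t; lra.
by move=> t v tab; apply: HD; lra.
Qed.

Lemma local_solution_flow m g a b : (0 < m)%N ->
  continuous_on (fun t => a <= t <= b) g -> (forall t, a <= t <= b -> sector (g t)) ->
  is_flow (m := m) g a b (fun t => local_solution (g t)).
Proof.
move=> m0 Cg Dg; split.
  move=> w; case: (lastP w) => [|w' x] t tab.
    apply: (filterlim_ext (fun _ => RtoC 1)) => [s|]; first by rewrite local_solution_nil.
    by rewrite local_solution_nil; exact: filterlim_const.
  have [CF _] := has_deriv_local_solution m0 w' x (Dg t tab).
  exact: filterlim_comp (Cg t tab) CF.
move=> t v tab Hv; split.
  apply: (is_velocity_ext (f := fun _ => RtoC 1)) => [s|]; first by rewrite local_solution_nil.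
  exact: is_velocity_const.
move=> w x; have tab' : a <= t <= b by lra.
have [_ HF] := has_deriv_local_solution m0 w x (Dg t tab').
exact: HF.
Qed.

Lemma ncmul1r m (S : ncseries m) w : ncmul S nc1 w = S w.
Proof.
rewrite -[RHS]ncmul1l; elim: w S => [|x w IH] S; first by rewrite !ncmul_nil Cmult_comm.
rewrite !ncmul_cons IH /= Cmult_0_r Cmult_1_l !Cplus_0_l ncmul1l.
by rewrite /ncmul big1 ?Cplus_0_r // => i _; rewrite Cmult_0_l.
Qed.

Section TangentialPath.

Variables (m : nat) (g : R -> C) (z : C).
Hypotheses (m0 : (0 < m)%N) (Tg : tangential_path m g z).

Lemma tangential_continuous : continuous_on (fun t => 0 <= t <= 1) g.
Proof. by case: Tg => /piecewise_continuous_on. Qed.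

Lemma tangential_lim0 : filterlim g (at_right 0) (locally (RtoC 0)).
Proof.
case: Tg => _ g0 _ _ _; rewrite -g0 => P HP.
have I0 : 0 <= 0 <= 1 by lra.
have [d Hd] := tangential_continuous I0 HP.
have d1 : 0 < Rmin d 1 by apply: Rmin_pos; [exact: cond_pos | lra].
exists (mkposreal _ d1) => s /Rabs_lt_between' /= s1 s0.
have := Rmin_l d 1; have := Rmin_r d 1 => ? ?.
by apply: Hd; [apply/Rabs_lt_between'; lra | lra].
Qed.

Lemma unit_direction t : 0 < t <= 1 -> g t = (g t / RtoC (Cmod (g t)) * RtoC (Cmod (g t)))%C.
Proof.
case: Tg => _ _ _ Vg _ t01; have [g0 _] := Vg t t01.
by field; apply: RtoC_neq0; have := proj1 (Cmod_gt_0 _) g0; lra.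
Qed.

Lemma tangential_sector : exists d, 0 < d < 1 /\ forall t, 0 < t <= d -> sector (g t).
Proof.
case: (Tg) => _ _ _ Vg /filterlim_CP/(_ (1 / 2)) D.
have [|d1 H1] := D; first lra.
have /filterlim_CP/(_ (1 / 8)) L := tangential_lim0.
have [|d2 H2] := L; first lra.
(* Halving keeps the closed bound t <= d strictly inside both neighbourhoods. *)
pose d := Rmin (Rmin d1 d2) 1 / 2.
have p1 := cond_pos d1; have p2 := cond_pos d2.
have q0 : 0 < Rmin (Rmin d1 d2) 1 by do !apply: Rmin_pos => //; lra.
have := Rmin_l (Rmin d1 d2) 1; have := Rmin_r (Rmin d1 d2) 1.
have := Rmin_l d1 d2; have := Rmin_r d1 d2 => ? ? ? ?.
exists d; split; first by rewrite /d; lra.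
rewrite /d => t td; have t01 : 0 < t <= 1 by lra.
have g0 := proj1 (Cmod_gt_0 _) (proj1 (Vg t t01)).
split; last first.
  have := H2 t _ (proj1 td); rewrite /Cminus Copp_0 Cplus_0_r; apply.
  by apply/Rabs_lt_between'; lra.
have := H1 t _ (proj1 td).
set u := (g t / _)%C => Hu; have {}Hu : Cmod (u - 1)%C < 1 / 2.
  by apply: Hu; apply/Rabs_lt_between'; lra.
(* A direction within 1/2 of 1 has positive real part, and [g t] is a positive multiple of it. *)
have K : Rabs (u.1 - 1) <= Cmod (u - 1)%C := Cmod_fst_le (u - 1)%C.
have u1 : 0 < u.1 by move: K; split_Rabs; lra.
by rewrite (unit_direction t01) -/u /= Rmult_0_r Rminus_0_r; apply: Rmult_lt_0_compat.
Qed.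

(** The difference is -i times the argument of [g e], which tends to 0 because the direction of the
    path tends to 1. *)
Lemma clog_asymptotic :
  filterlim (fun e => RtoC (ln (Cmod (g e))) - clog (g e))%C (at_right 0) (locally (RtoC 0)).
Proof.
case: (Tg) => _ _ _ Vg Dg; have [d [d01 Sd]] := tangential_sector.
pose u e := (g e / RtoC (Cmod (g e)))%C.
apply: (filterlim_ext_loc (fun e => (0, - atan ((u e).2 / (u e).1)))).
  exists (mkposreal _ (proj1 d01)) => e /Rabs_lt_between' /= ed e0.
  have e01 : 0 < e <= 1 by lra.
  have ed' : 0 < e <= d by lra.
  have [s1 _] := Sd e ed'.
  have g0 := proj1 (Cmod_gt_0 _) (proj1 (Vg e e01)).
  have -> : (u e).2 / (u e).1 = (g e).2 / (g e).1.
    rewrite [in RHS](unit_direction e01) -/(u e) /= !Rmult_0_r Rminus_0_r Rplus_0_l.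
    have : (g e).1 = (u e).1 * Cmod (g e).
      by rewrite {1}(unit_direction e01) -/(u e) /= Rmult_0_r Rminus_0_r.
    move=> E; have : (u e).1 <> 0 by move=> E'; rewrite E' Rmult_0_l in E; lra.
    by move=> u0; field; split=> //; lra.
  by rewrite /clog; apply: injective_projections => /=; ring.
apply: filterlim_Cpair; first exact: filterlim_const.
have D1 : filterlim (fun e => (u e).1) (at_right 0) (locally (RtoC 1).1).
  by apply: filterlim_Cfst; exact: Dg.
have D2 : filterlim (fun e => (u e).2) (at_right 0) (locally (RtoC 1).2).
  by apply: filterlim_Csnd; exact: Dg.
have n1 : (RtoC 1).1 <> 0 by rewrite /=; lra.
have D3 : filterlim (fun e => (u e).2 * / (u e).1) (at_right 0)
    (locally ((RtoC 1).2 * / (RtoC 1).1)).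
  by apply: filterlim_Rmult => //; exact: filterlim_Rinv.
have D4 : filterlim (fun e => - atan ((u e).2 * / (u e).1)) (at_right 0)
    (locally (- atan ((RtoC 1).2 * / (RtoC 1).1))).
  apply: filterlim_Ropp.
  exact: (filterlim_comp _ _ _ _ atan _ _ _ D3 (continuous_atan _)).
have E : - atan ((RtoC 1).2 * / (RtoC 1).1) = 0 by rewrite /= Rmult_0_l atan_0 Ropp_0.
by rewrite E in D4; exact: D4.
Qed.

Lemma small_filterlim f : small f ->
  filterlim (fun e => f (g e)) (at_right 0) (locally (RtoC 0)).
Proof.
move=> sf; apply/filterlim_CP => eps eps0.
have [d [d0 Hd]] := small_lim sf eps0; have [d' [d'01 Sd]] := tangential_sector.
have /filterlim_CP/(_ d d0) L := tangential_lim0.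
have L' : at_right 0 (fun e => 0 < e <= d').
  by exists (mkposreal _ (proj1 d'01)) => e /Rabs_lt_between' /= ? ?; lra.
apply: filter_imp (filter_and _ _ L L') => e [].
rewrite /Cminus Copp_0 !Cplus_0_r => ed e0.
by apply: Hd => //; exact: Sd.
Qed.

(** The product is the value at 1 of the flow that continues [local_solution] along the path beyond
    the sector; it is determined by its value at [d], whatever the starting time e. *)
Lemma transport_local_solution : exists (d : R) (Psi : ncseries m), 0 < d /\
  forall e w, 0 < e < d -> ncmul (local_solution (g e)) (transport m g e 1) w = Psi w.
Proof.
case: (Tg) => Pg _ _ Vg _; have [d [d01 Sd]] := tangential_sector.
have [l Hl] := piecewise_velocity Pg.
exists d, (ncmul (local_solution (g d)) (transport m g d 1)); split; first by lra.
move=> e w ed.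
have e01 : 0 < e < 1 by lra.
have [Phi HPhi] := transport_exists m0 Pg Vg e01.
have [Phi' HPhi'] := transport_exists m0 Pg Vg d01.
have Hle t : e < t < 1 -> ~ List.In t l -> exists v, is_velocity g t v.
  by move=> te; apply: Hl; lra.
have Hld t : d < t < 1 -> ~ List.In t l -> exists v, is_velocity g t v.
  by move=> te; apply: Hl; lra.
have e1 : e <= 1 by lra. have d1 : d <= 1 by lra. have ed' : e <= d by lra.
rewrite (eq_ncmul (T' := Phi 1) w (fun _ => erefl)); last first.
  by move=> u; exact: transport_eq e1 Hle HPhi.
rewrite [RHS](eq_ncmul (T' := Phi' 1) w (fun _ => erefl)); last first.
  by move=> u; exact: transport_eq d1 Hld HPhi'.
case/solves_transport_flow: HPhi => FPhi Phi0; case/solves_transport_flow: HPhi' => FPhi' Phi'0.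
have FA := is_flow_ncmul (local_solution (g e)) FPhi.
have FB := is_flow_ncmul (local_solution (g d)) FPhi'.
(* On [e, d] the path stays in the sector, and both series are flows with the same value at [e]. *)
have start u : ncmul (local_solution (g e)) (Phi d) u = local_solution (g d) u.
  apply: (flow_unique (l := l) ed' _ (is_flow_sub (Rle_refl e) d1 FA)
    (local_solution_flow (a := e) (b := d) m0 _ _)) => [t te|||u'|].
  - by apply: Hle; lra.
  - by apply: continuous_on_subset tangential_continuous => t; lra.
  - by move=> t te; apply: Sd; lra.
  - by rewrite (eq_ncmul (T' := nc1) u' (fun _ => erefl)) // ncmul1r.
  - lra.
apply: (flow_unique (l := l) d1 Hld (is_flow_sub ed' (Rle_refl 1) FA) FB) => [u|]; last lra.
by rewrite start (eq_ncmul (T' := nc1) u (fun _ => erefl)) // ncmul1r.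
Qed.

(** Each term is a coefficient of the remainder times a multiple of a power of the logarithm, so the
    class absorbs the growth of exp(- log z X). *)
Lemma small_correction w :
  small (fun y => ncmul (remainder (m := m) y) (ncexpX (- clog y)%C) w).
Proof.
apply: small_sum => k; have sR := small_remainder m0 (take k w).
set u := drop k w; case Hu: (all (pred1 letterX) u); last first.
  by apply: small_ext small0 => y _; rewrite ncexpXE Hu Cmult_0_r.
apply: small_ext (small_scal (Cpow (RtoC (-1)) (size u) / RtoC (INR (size u)`!))%C
  (small_clog_pow (size u) sR)) => y _.
rewrite ncexpXE Hu /divpow.
replace (- clog y)%C with (RtoC (-1) * clog y)%C by ring.
by rewrite Cpow_mult_l /Cdiv; ring.
Qed.

Lemma filterlim_ncexpX (T : Type) (F : (T -> Prop) -> Prop) {FF : Filter F} (c : T -> C) a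
  (w : word m) :
  filterlim c F (locally a) -> filterlim (fun x => ncexpX (c x) w) F (locally (ncexpX a w)).
Proof.
move=> Hc; rewrite ncexpXE.
apply: (filterlim_ext (fun x => if all (pred1 letterX) w then divpow (c x) (size w) else
  RtoC 0)) => //.
case: ifP => _; last exact: filterlim_Cconst.
by apply: filterlim_Cmult; [exact: filterlim_Cpow | exact: filterlim_Cconst].
Qed.

(* With [G = exp(log g X) + R] the local solution, [G T] is a constant series
   [Psi]; writing [U = exp(log g X) T] and [N = R exp(- log g X)], this reads
   [(1 + N) U = Psi] with [N -> 0], whence [U -> Psi]. *)
Lemma regularized_transport_cvg : exists Psi : ncseries m, forall w,
  filterlim (fun e => ncmul (ncexpX (RtoC (ln (Cmod (g e))))) (transport m g e 1) w)
    (at_right 0) (locally (Psi w)).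
Proof.
have [d [Psi [d0 HPsi]]] := transport_local_solution; exists Psi.
pose N e := ncmul (remainder (m := m) (g e)) (ncexpX (- clog (g e))%C).
pose U e := ncmul (ncexpX (m := m) (clog (g e))) (transport m g e 1).
have HN w : filterlim (fun e => N e w) (at_right 0) (locally (RtoC 0)).
  exact: small_filterlim (small_correction w).
have NU e w : 0 < e < d -> (U e w + ncmul (N e) (U e) w)%C = Psi w.
  move=> ed; rewrite -(HPsi e w ed) /N /U -ncmulA.
  have -> : ncmul (remainder (g e)) (ncmul (ncexpX (- clog (g e))%C)
      (ncmul (ncexpX (clog (g e))) (transport m g e 1))) w =
      ncmul (remainder (g e)) (transport m g e 1) w.
    apply: eq_ncmul => // u; rewrite ncmulA (eq_ncmul (S' := nc1) (T' := transport m g e 1)) //.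
      exact: ncmul1l.
    by move=> u'; rewrite ncexpXD -(ncexpX0 u'); congr (ncexpX _ u'); ring.
  have := ncmul_linearl 1 (ncexpX (clog (g e))) (remainder (g e)) (transport m g e 1) w.
  by rewrite Cmult_1_l => <-; apply: eq_ncmul => // u; rewrite /local_solution Cmult_1_l.
have HU w : filterlim (fun e => U e w) (at_right 0) (locally (Psi w)).
  (* Strong induction on the length: [N] has no constant term, so its product with [U] involves [U]
     only at proper suffixes of [w], where the limit is known. *)
  have [k] := ubnP (size w); elim: k w => // k IH w wk.
  pose S e := \big[Cplus/RtoC 0]_(i < size w) (N e (take i.+1 w) * U e (drop i.+1 w))%C.
  apply: (filterlim_ext_loc (fun e => Psi w - S e)%C).
    exists (mkposreal _ d0) => e /Rabs_lt_between' /= ed e0.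
    have ed' : 0 < e < d by lra.
    have N0 : N e [::] = 0 by rewrite /N ncmul_nil remainder_nil Cmult_0_l.
    have := NU e w ed'; rewrite {1}/ncmul big_ord_recl take0 drop0 N0 Cmult_0_l Cplus_0_l.
    have -> : \big[Cplus/RtoC 0]_(i < size w) (N e (take (lift ord0 i) w) *
        U e (drop (lift ord0 i) w))%C = S e by apply: eq_bigr.
    by move=> <-; ring.
  have E : (Psi w - 0)%C = Psi w by ring.
  rewrite -[in X in filterlim _ _ X]E.
  apply: filterlim_Cminus; first exact: filterlim_Cconst.
  have -> : RtoC 0 = \big[Cplus/RtoC 0]_(i < size w) (0 * Psi (drop i.+1 w))%C.
    by rewrite big1 // => i _; rewrite Cmult_0_l.
  apply: filterlim_Csum => i; apply: filterlim_Cmult; first exact: HN.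
  apply: IH; rewrite size_drop; apply: leq_trans (_ : size w <= k)%N; last by [].
  by rewrite ltn_subrL /= (leq_ltn_trans _ (ltn_ord i)).
move=> w.
(* Passing from log g to ln |g| multiplies by an exponential that tends to 1. *)
apply: (filterlim_ext (fun e => ncmul (ncexpX (RtoC (ln (Cmod (g e))) - clog (g e))%C) (U e) w)).
  move=> e; rewrite /U ncmulA; apply: eq_ncmul => // u; rewrite ncexpXD.
  by congr (ncexpX _ u); ring.
rewrite -(ncmul1l Psi w); apply: filterlim_Csum => k; apply: filterlim_Cmult; last exact: HU.
by rewrite -ncexpX0; apply: filterlim_ncexpX; exact: clog_asymptotic.
Qed.

End TangentialPath.

Lemma at_right_proper' x : ProperFilter' (at_right x).
Proof. exact: Proper_StrongProper (at_right_proper_filter x). Qed.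

Lemma Lambda_eq m g w c :
  filterlim (fun e => ncmul (ncexpX (RtoC (ln (Cmod (g e))))) (transport m g e 1) w)
    (at_right 0) (locally c) -> Lambda m g w = c.
Proof.
exact: (@iota_filterlim_locally _ C_R_CompleteNormedModule _ _ (at_right_proper' 0)).
Qed.

Theorem theorem2p3 :
  forall (r n : nat), (0 < r)%N -> (0 < n)%N ->
  forall (z : C) (gamma : R -> C), tangential_path (r * n) gamma z ->
  forall w : word r, w <> [::] ->
    Li w (cover_path n gamma) =
    Cmult (Cpow (RtoC (INR n)) (wtX w))
      (\big[Cplus/RtoC 0]_(u : (size w).-tuple (letter (r * n))
                             | word_mod (tval u) == w)
         Li (tval u) gamma).
Proof.
move=> r n r0 n0 z g Tg w _; have rn0 : (0 < r * n)%N by rewrite muln_gt0 r0.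
have [Psi HPsi] := regularized_transport_cvg rn0 Tg.
rewrite (sumlift_tuple (Lambda (r * n) g)) -/(push (Lambda (r * n) g) w).
rewrite (eq_push (T := Psi)) => [|u]; last exact: Lambda_eq.
apply: Lambda_eq.
(* The limit on [V_rn] is pushed forward; it remains to identify the regularized transports for e in
   (0, 1). *)
apply: (filterlim_ext_loc (fun e => push
  (ncmul (ncexpX (RtoC (ln (Cmod (g e))))) (transport (r * n) g e 1)) w)); last first.
  by apply: filterlim_push.
case: (Tg) => Pg _ _ Vg _; have [l Hl] := piecewise_velocity Pg.
exists (mkposreal _ Rlt_0_1) => e /Rabs_lt_between' /= ed e0.
have e01 : 0 < e < 1 by lra.
have e1 : e <= 1 by lra.
have [Phi HPhi] := transport_exists rn0 Pg Vg e01.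
have Hle t : e < t < 1 -> ~ List.In t l -> exists v, is_velocity g t v.
  by move=> te; apply: Hl; lra.
have Cg t : e < t < 1 -> continuous g t.
  move=> te; apply: (continuous_continuous_on _ _ _ _ (piecewise_continuous_on Pg)).
  have p0 : 0 < Rmin t (1 - t) by apply: Rmin_pos; lra.
  exists (mkposreal _ p0) => s /Rabs_lt_between' /=.
  by have := Rmin_l t (1 - t); have := Rmin_r t (1 - t); lra.
have Vg' t : e < t < 1 -> V (r * n) (g t) by move=> te; apply: Vg; lra.
have HPhi' := solves_transport_cover r0 n0 Cg Vg' HPhi.
(* Uniqueness on [V_r] needs velocities of the image path off the same finite set. *)
have Hle' t : e < t < 1 -> ~ List.In t l -> exists v, is_velocity (cover_path n g) t v.
  move=> te tl; have [v Hv] := Hle t te tl.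
  by case: n n0 {rn0 Tg Psi HPsi Vg Vg' Phi HPhi HPhi'} => // n _; eexists;
    exact: is_velocity_cover Hv.
rewrite push_mul; apply: eq_ncmul => u.
  rewrite push_expX; congr (ncexpX _ u); rewrite -RtoC_mult; congr RtoC.
  rewrite /cover_path Cmod_pow.
  have g0 := proj1 (Cmod_gt_0 _) (proj1 (Vg e (conj e0 e1))).
  by elim: (n) => [|k IH]; [rewrite /= ln_1 Rmult_0_l | rewrite -tech_pow_Rmult ln_mult //
    -?IH ?S_INR; [ring | exact: pow_lt]].
rewrite (transport_eq u e1 Hle' HPhi'); apply: eq_push => v.
by rewrite (transport_eq v e1 Hle HPhi).
Qed.
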